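(* Every closed ideal $\mathcal I$ of the Fréchet algebra $C^\infty(\mathbb R)$, regarded as a Fréchet space with the topology induced from $C^\infty(\mathbb R)$, satisfies property $(\Omega)$.
   Context: $C^\infty(\mathbb R)$ is the algebra (under pointwise multiplication) of scalar-valued (real or complex) smooth functions on $\mathbb R$, with the Fréchet space topology given by the seminorms $\|f\|_n=\sup\{|f^{(j)}(x)|: |x|\le n,\ 0\le j\le n\}$, $n\in\mathbb N$. A Fréchet space $X$ with an increasing fundamental sequence of seminorms $(\|\cdot\|_n)_{n\in\mathbb N}$ satisfies $(\Omega)$ if: for every $n\in\mathbb N$ there is $m\ge n$ such that for every $k\ge m$ there are $s\in\mathbb N$ and $c>0$ such that for every $\varepsilon>0$ and every $x\in X$ with $\|x\|_m\le 1$ there is $y\in X$ with $\|x-y\|_n\le\varepsilon$ and $\|y\|_k\le c\,\varepsilon^{-s}$. (This does not depend on the choice of the fundamental sequence of seminorms.) *)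

(* Defs.v *)
From HB Require Import structures.
From mathcomp Require Import all_boot all_order all_algebra.
From mathcomp Require Import complex ring.
From mathcomp Require Import all_classical all_reals.
From mathcomp Require Import interval_inference topology normedtype derive.
Set Implicit Arguments.
Unset Strict Implicit.
Unset Printing Implicit Defensive.
Import Order.TTheory GRing.Theory Num.Theory.
Import numFieldNormedType.Exports.
Local Open Scope classical_set_scope.
Local Open Scope ring_scope.

(* Commutative unital normed algebras over the reals. The product is a mixin field
   because MathComp has no structure joining rings with normed modules
   over another ring; it is the usual product *%R for the two scalar fields R
   and C below, the only instances. *)
HB.mixin Record NormedModule_isNormedComAlg (R : realType) K
    of NormedModule R K := {
  amul : K -> K -> K;
  aone : K;
  amulA : associative amul;
  amulC : commutative amul;
  amul1 : left_id aone amul;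
  amulDl : left_distributive amul +%R;
  ascaleAl : forall (l : R) x y, l *: amul x y = amul (l *: x) y;
  aone_neq0 : aone != 0;
  ler_norm_amul : forall x y, `|amul x y| <= `|x| * `|y|
}.

#[short(type="normedComAlgType")]
HB.structure Definition NormedComAlg (R : realType) :=
  {K of NormedModule R K & NormedModule_isNormedComAlg R K}.

Section real_scalars.
Variable R : realType.

Let normM (x y : R) : `|x * y| <= `|x| * `|y|.
Proof. by rewrite normrM. Qed.

Let scaleAl (l x y : R) : l *: (x * y) = l *: x * y.
Proof. exact: mulrA. Qed.

HB.instance Definition _ := NormedModule_isNormedComAlg.Build R R
  (@mulrA R) (@mulrC R) (@mul1r R) (@mulrDl R) scaleAl (@oner_neq0 R) normM.
End real_scalars.

(* [Rcomplex R] is the field R[i] regarded as a real vector space, normed by the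
   R-valued modulus. *)
Section complex_scalars.
Variable R : realType.
Local Notation C := (Rcomplex R).

HB.instance Definition _ := PseudoMetric.copy C (pseudoMetric_normed C).
HB.instance Definition _ := isPointed.Build C 0.
HB.instance Definition _ := NormedZmod_PseudoMetric_eq.Build R C erefl.

Let normcZ (l : R) (x : C) : `|l *: x| = `|l| * `|x|.
Proof.
case: x => a b; rewrite /Num.norm /= !exprMn -mulrDr sqrtrM ?sqr_ge0 //.
by rewrite sqrtr_sqr.
Qed.

HB.instance Definition _ :=
  PseudoMetricNormedZmod_Lmodule_isNormedModule.Build R C normcZ.

Let normcM (x y : C) : `|x * y : C| <= `|x| * `|y|.
Proof.
case: x y => a b [c d]; rewrite /Num.norm /= -sqrtrM ?addr_ge0 ?sqr_ge0 //.
rewrite ler_wsqrtr // le_eqVlt; apply/orP; left; apply/eqP; ring.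
Qed.

HB.instance Definition _ := NormedModule_isNormedComAlg.Build R C
  (@mulrA C) (@mulrC C) (@mul1r C) (@mulrDl C) (@scalerAl R C)
  (@oner_neq0 C) normcM.
End complex_scalars.

Section amul_theory.
Variables (R : realType) (K : normedComAlgType R).
Implicit Types x y z : K.

Lemma amulDr : right_distributive (@amul R K) +%R.
Proof. by move=> x y z; rewrite amulC amulDl !(amulC x). Qed.

Lemma ascaleAr (l : R) x y : l *: amul x y = amul x (l *: y).
Proof. by rewrite amulC ascaleAl amulC. Qed.

Let amul_is_bilinear :
  bilinear_for
    (GRing.Scale.Law.clone _ _ *:%R _) (GRing.Scale.Law.clone _ _ *:%R _)
    (@amul R K).
Proof.
split=> [u'|u] a x y /=; first by rewrite amulDl ascaleAl.
by rewrite amulDr ascaleAr.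
Qed.

HB.instance Definition _ :=
  bilinear_isBilinear.Build R K K K _ _ (@amul R K) amul_is_bilinear.

Lemma amulBl x y z : amul (x - y) z = amul x z - amul y z.
Proof. exact: linearBl. Qed.
Lemma amulBr x y z : amul x (y - z) = amul x y - amul x z.
Proof. exact: linearBr. Qed.

Lemma amul_continuous : continuous (fun p : K * K => amul p.1 p.2).
Proof.
move=> [x y]; apply/cvgrPdist_lt => _/posnumP[e] /=.
have M0 : 0 < `|x| + `|y| + 1 by rewrite ltr_wpDl ?addr_ge0.
pose M := `|x| + `|y| + 1.
have eM0 : 0 < e%:num / 2 / M by rewrite divr_gt0.
near=> p.
have -> : amul x y - amul p.1 p.2 = amul (x - p.1) y + amul p.1 (y - p.2).
  by rewrite amulBl amulBr addrA subrK.
have p1M : `|p.1| <= M.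
  rewrite -(subrK x p.1) (le_trans (ler_normD _ _))// addrC /M -addrA lerD//.
  rewrite (@le_trans _ _ 1) ?lerDr// distrC ltW//.
  near: p; apply: (@cvgr_dist_lt _ _ _ _ _ fst) => //; exact: cvg_fst.
rewrite (le_lt_trans (ler_normD _ _))//.
rewrite (le_lt_trans (lerD (ler_norm_amul _ _) (ler_norm_amul _ _)))//.
rewrite (splitr e%:num) ltrD//.
- rewrite (@le_lt_trans _ _ (`|x - p.1| * M)) ?ler_wpM2l// ?/M.
    by rewrite -addrA addrCA lerDl addr_ge0.
  rewrite -ltr_pdivlMr//.
  by near: p; apply: (@cvgr_dist_lt _ _ _ _ _ fst) => //; exact: cvg_fst.
- rewrite (@le_lt_trans _ _ (M * `|y - p.2|)) ?ler_wpM2r//.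
  rewrite -ltr_pdivlMl// mulrC.
  by near: p; apply: (@cvgr_dist_lt _ _ _ _ _ snd) => //; exact: cvg_snd.
Unshelve. all: by end_near. Qed.

End amul_theory.

Local Notation "f ^` ()" := (derive1 f) : ring_scope.
Local Notation "f ^` ( n )" := (derive1n n f) : ring_scope.
Section smooth.
Variables (R : realType) (K : normedModType R).
Implicit Types f g : R -> K.

Definition smooth f := forall n x, derivable (f^`(n)) x 1.

(* A class of differentiable functions stable under derivation consists of
   smooth functions. *)
Lemma smooth_class (S : set (R -> K)) :
  (forall f, S f -> (forall x, derivable f x 1) /\ S f^`()) ->
  forall f, S f -> smooth f.
Proof.
move=> HS f Sf n; suff : S f^`(n) by case/HS.
by elim: n => [//|n IH]; rewrite derive1nS; case: (HS _ IH).
Qed.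

Lemma smooth_derivable f x : smooth f -> derivable f x 1.
Proof. by move=> /(_ 0%N x). Qed.

Lemma smooth_derive1 f : smooth f -> smooth f^`().
Proof. by move=> sf n; rewrite -derive1Sn. Qed.

Lemma smooth_derive1n f n : smooth f -> smooth f^`(n).
Proof. by move=> sf; elim: n => //= n; exact: smooth_derive1. Qed.

Lemma smooth_cst (k : K) : smooth (cst k).
Proof.
apply: (@smooth_class [set f | exists k, f = cst k]); last by exists k.
move=> _ [c ->]; split=> [x|]; first exact: derivable_cst.
by exists 0; apply/funext => x; rewrite derive1_cst.
Qed.

Lemma derive1D f g : smooth f -> smooth g -> (f + g)^`() = f^`() + g^`().
Proof.
move=> sf sg; apply/funext => x.
by rewrite derive1E deriveD -?derive1E//; exact: smooth_derivable.
Qed.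

Lemma derive1Z (k : R) f : smooth f -> (k *: f)^`() = k *: f^`().
Proof.
move=> sf; apply/funext => x.
by rewrite derive1E deriveZ -?derive1E//; exact: smooth_derivable.
Qed.

Lemma smoothD f g : smooth f -> smooth g -> smooth (f + g).
Proof.
move=> sf sg; apply: (@smooth_class [set h | exists f g,
  [/\ smooth f, smooth g & h = f + g]]); last by exists f, g.
move=> _ [f1 [g1 [sf1 sg1 ->]]]; split=> [x|].
  by apply: derivableD; exact: smooth_derivable.
by exists f1^`(), g1^`(); split; [exact: smooth_derive1..|exact: derive1D].
Qed.

Lemma smoothZ (k : R) f : smooth f -> smooth (k *: f).
Proof.
move=> sf; apply: (@smooth_class [set h | exists f,
  smooth f /\ h = k *: f]); last by exists f.
move=> _ [f1 [sf1 ->]]; split=> [x|].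
  by apply: derivableZ; exact: smooth_derivable.
by exists f1^`(); split; [exact: smooth_derive1|exact: derive1Z].
Qed.

Lemma smoothB f g : smooth f -> smooth g -> smooth (f - g).
Proof.
by move=> sf sg; apply: smoothD => //; rewrite -scaleN1r; exact: smoothZ.
Qed.

Lemma derive1nD n f g : smooth f -> smooth g ->
  (f + g)^`(n) = f^`(n) + g^`(n).
Proof.
move=> sf sg; elim: n => //= n ->.
by rewrite derive1D//; exact: smooth_derive1n.
Qed.

Lemma derive1nZ n (k : R) f : smooth f -> (k *: f)^`(n) = k *: f^`(n).
Proof. by move=> sf; elim: n => //= n ->; rewrite derive1Z//; exact: smooth_derive1n. Qed.

Lemma smooth_bounded n f : smooth f ->
  exists M, forall j x, (j <= n)%N -> `|x| <= n%:R -> `|f^`(j) x| <= M.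
Proof.
move=> sf.
have B j : exists M, forall x, `|x| <= n%:R -> `|f^`(j) x| <= M.
  have cf : {within `[- n%:R, n%:R]%classic, continuous f^`(j)}.
    apply: continuous_subspaceT => x; apply: differentiable_continuous.
    by apply/derivable1_diffP; exact: sf.
  have /compact_bounded[M [_ HM]] :=
    continuous_compact cf (@segment_compact R (- n%:R) n%:R).
  exists (M + 1) => x xn; apply: (HM (M + 1)); first by rewrite ltrDl.
  by exists x => //=; rewrite in_itv/= -ler_norml.
have [M HM] := choice B.
exists (\sum_(j < n.+1) `|M j|) => j x jn xn.
rewrite (le_trans (HM j x xn))// (le_trans (ler_norm _))//.
rewrite -ltnS in jn.
by rewrite (bigD1 (Ordinal jn))//= lerDl sumr_ge0.
Qed.
End smooth.
Arguments smooth_cst {R K} k.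

Section smoothM.
Variables (R : realType) (K : normedComAlgType R).

Lemma is_derive_amul (f g : R -> K) (x : R) df dg :
  is_derive x 1 f df -> is_derive x 1 g dg ->
  is_derive x 1 (fun y => amul (f y) (g y)) (amul df (g x) + amul (f x) dg).
Proof.
move=> [fd <-] [gd <-].
have fD : differentiable f x by exact/derivable1_diffP.
have gD : differentiable g x by exact/derivable1_diffP.
have pD := differentiable_pair fD gD.
have aD := @differentiable_bilin R K K K (@amul R K) (f x, g x)
   (@amul_continuous R K).
have cD : differentiable (fun y => amul (f y) (g y)) x.
  exact: (differentiable_comp pD aD).
apply: DeriveDef; first exact/derivable1_diffP.
rewrite deriveE//.
rewrite (_ : (fun y => _) = (fun p => amul p.1 p.2) \o (fun y => (f y, g y)))//.
rewrite diff_comp//= diff_pair//.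
by rewrite (diff_bilin _ (@amul_continuous R K))/= -!deriveE// addrC.
Qed.

Inductive prodsum : set (R -> K) :=
| Prodsum1 f g : smooth f -> smooth g -> prodsum (fun x => amul (f x) (g x))
| ProdsumD f g : prodsum f -> prodsum g -> prodsum (f + g).

Let prodsum_derive (h : R -> K) :
  prodsum h -> (forall x, derivable h x 1) /\ prodsum h^`().
Proof.
elim=> [f g sf sg|f g _ [df pf] _ [dg pg]].
  have D (x : R) : is_derive x 1 (fun y : R => amul (f y) (g y))
      (amul (f^`() x) (g x) + amul (f x) (g^`() x)).
    rewrite !derive1E; apply: is_derive_amul;
      by apply: derivableP; exact: smooth_derivable.
  split=> [x|]; first by case: (D x).
  rewrite (_ : _^`() = (fun x => amul (f^`() x) (g x)) +
                       (fun x => amul (f x) (g^`() x))); last first.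
    by apply/funext => x; rewrite derive1E derive_val.
  by apply: ProdsumD; apply: Prodsum1 => //; exact: smooth_derive1.
split=> [x|]; first exact: derivableD.
rewrite (_ : _^`() = f^`() + g^`()); first exact: ProdsumD.
by apply/funext => x; rewrite derive1E deriveD// -!derive1E.
Qed.

Lemma smooth_amul (f g : R -> K) : smooth f -> smooth g ->
  smooth (fun x => amul (f x) (g x)).
Proof.
by move=> sf sg; apply: (smooth_class prodsum_derive); exact: Prodsum1.
Qed.
End smoothM.

Definition smooth_pred (R : realType) (K : normedModType R) : {pred R -> K} :=
  fun f => `[< smooth f >].

Record Cinfty (R : realType) (K : normedModType R) := MkCinfty {
  Cinfty_fun :> R -> K;
  Cinfty_subproof : Cinfty_fun \in @smooth_pred R K
}.

Section Cinfty_lmodule.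
Variables (R : realType) (K : normedModType R).
Local Notation C := (Cinfty K).

HB.instance Definition _ := [isSub for @Cinfty_fun R K].
HB.instance Definition _ := [Choice of C by <:].

Lemma CinftyP (f : C) : smooth f.
Proof. exact/asboolP/Cinfty_subproof. Qed.

Definition mkCinfty (f : R -> K) (sf : smooth f) : C :=
  MkCinfty (introT (asboolP _) sf).

Let smooth_submod_closed : submod_closed (@smooth_pred R K).
Proof.
split; first exact/asboolP/smooth_cst.
move=> a f g /asboolP sf /asboolP sg.
by apply/asboolP/smoothD => //; exact: smoothZ.
Qed.

HB.instance Definition _ :=
  GRing.isSubmodClosed.Build R (R -> K) (@smooth_pred R K) smooth_submod_closed.
HB.instance Definition _ := [SubChoice_isSubLmodule of C by <:].

Lemma Cinfty_ext (f g : C) : f =1 g -> f = g.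
Proof. by move=> fg; apply/val_inj/funext. Qed.

Lemma CinftyDE (f g : C) x : (f + g) x = f x + g x. Proof. by []. Qed.
Lemma CinftyBE (f g : C) x : (f - g) x = f x - g x. Proof. by []. Qed.
Lemma CinftyZE (k : R) (f : C) x : (k *: f) x = k *: f x. Proof. by []. Qed.
End Cinfty_lmodule.
Arguments CinftyP {R K} f.

Section Cinfty_algebra.
Variables (R : realType) (K : normedComAlgType R).
Local Notation C := (Cinfty K).

Let mul (f g : C) : C := mkCinfty (smooth_amul (CinftyP f) (CinftyP g)).
Let one : C := mkCinfty (smooth_cst (aone : K)).

Let mulA : associative mul.
Proof. by move=> f g h; apply: Cinfty_ext => x; exact: amulA. Qed.
Let mulC : commutative mul.
Proof. by move=> f g; apply: Cinfty_ext => x; exact: amulC. Qed.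
Let mul1 : left_id one mul.
Proof. by move=> f; apply: Cinfty_ext => x; exact: amul1. Qed.
Let mulDl : left_distributive mul +%R.
Proof. by move=> f g h; apply: Cinfty_ext => x; exact: amulDl. Qed.
Let one_neq0 : one != 0.
Proof.
apply/eqP => /(congr1 (fun f : C => f 0)) /= /eqP.
by rewrite (negbTE aone_neq0).
Qed.

HB.instance Definition _ :=
  GRing.Zmodule_isComNzRing.Build C mulA mulC mul1 mulDl one_neq0.

Let scaleAl (k : R) (f g : C) : k *: (f * g) = k *: f * g.
Proof. by apply: Cinfty_ext => x; exact: ascaleAl. Qed.

HB.instance Definition _ := GRing.Lmodule_isLalgebra.Build R C scaleAl.
HB.instance Definition _ := GRing.Lalgebra_isComAlgebra.Build R C.

Lemma CinftyME (f g : C) x : (f * g) x = amul (f x) (g x). Proof. by []. Qed.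
End Cinfty_algebra.

Section Cinfty_topology.
Variables (R : realType) (K : normedModType R).
Local Notation C := (Cinfty K).
Implicit Types f g h : C.

Definition seminorm (n : nat) f : R :=
  sup [set r | exists j x, [/\ (j <= n)%N, `|x| <= n%:R
                             & r = `|derive1n j f x|]].

Lemma seminorm_ub n f j x : (j <= n)%N -> `|x| <= n%:R ->
  `|derive1n j f x| <= seminorm n f.
Proof.
move=> jn xn; apply: ub_le_sup; last by exists j, x.
have [M HM] := smooth_bounded n (CinftyP f).
by exists M => _ [i [y [? ? ->]]]; exact: HM.
Qed.

Lemma seminorm_le n f (M : R) :
  (forall j x, (j <= n)%N -> `|x| <= n%:R -> `|derive1n j f x| <= M) ->
  seminorm n f <= M.
Proof.
move=> HM; apply: ge_sup; first by exists `|derive1n 0 f 0|, 0%N, 0; rewrite normr0.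
by move=> _ [j [x [? ? ->]]]; exact: HM.
Qed.

Lemma seminorm_ge0 n f : 0 <= seminorm n f.
Proof. by apply: le_trans (@seminorm_ub n f 0 0 _ _); rewrite ?normr0. Qed.

Lemma seminormD n f g : seminorm n (f + g) <= seminorm n f + seminorm n g.
Proof.
apply: seminorm_le => j x jn xn.
rewrite [X in derive1n _ X](_ : _ = (f : R -> K) + (g : R -> K))//.
rewrite (derive1nD _ (CinftyP f) (CinftyP g)) (le_trans (ler_normD _ _))//.
by apply: lerD; exact: seminorm_ub.
Qed.

Let seminormZ_le n (k : R) f : seminorm n (k *: f) <= `|k| * seminorm n f.
Proof.
apply: seminorm_le => j x jn xn.
rewrite [X in derive1n _ X](_ : _ = k *: (f : R -> K))//.
rewrite (derive1nZ _ _ (CinftyP f)) normrZ.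
by rewrite ler_wpM2l//; exact: seminorm_ub.
Qed.

Lemma seminorm0 n : seminorm n 0 = 0.
Proof.
apply/le_anti; rewrite seminorm_ge0 andbT -[X in seminorm n X](scale0r (0 : C)).
by rewrite (le_trans (seminormZ_le _ _ _))// normr0 mul0r.
Qed.

Lemma seminormZ n (k : R) f : seminorm n (k *: f) = `|k| * seminorm n f.
Proof.
apply/le_anti; rewrite seminormZ_le /=.
have [->|k0] := eqVneq k 0; first by rewrite scale0r seminorm0 normr0 mul0r.
rewrite -ler_pdivlMl ?normr_gt0// -normfV.
by rewrite -[X in seminorm n X <= _](scalerK k0)// seminormZ_le.
Qed.

Lemma seminormN n f : seminorm n (- f) = seminorm n f.
Proof. by rewrite -scaleN1r seminormZ normrN1 mul1r. Qed.

Lemma seminorm_homo f : {homo seminorm ^~ f : m n / (m <= n)%N >-> m <= n}.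
Proof.
move=> m n mn; apply: seminorm_le => j x jm xm.
by apply: seminorm_ub; rewrite (leq_trans jm, le_trans xm)// ler_nat.
Qed.

(* Since the seminorms increase with n, the balls of the single seminorms form
   a basis of neighbourhoods. *)
Definition Cinfty_nbhs f : set_system C :=
  [set A | exists n (e : R), 0 < e /\ [set g | seminorm n (g - f) < e] `<=` A].

HB.instance Definition _ := hasNbhs.Build C Cinfty_nbhs.

Let Cinfty_nbhs_filter f : ProperFilter (nbhs f).
Proof.
split=> [[n [e [e0 /(_ f)]]]|]; first by apply; rewrite /= subrr seminorm0.
split.
- by exists 0%N, 1.
- move=> A B [m [d [d0 mA]]] [n [e [e0 nB]]].
  exists (maxn m n), (Num.min d e); split; first by rewrite lt_min d0.
  move=> g /=; rewrite lt_min => /andP[gd ge]; split.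
    by apply: mA; apply: le_lt_trans gd; apply/seminorm_homo/leq_maxl.
  by apply: nB; apply: le_lt_trans ge; apply/seminorm_homo/leq_maxr.
- move=> A B AB [n [e [e0 nA]]]; exists n, e; split=> //.
  exact: subset_trans AB.
Qed.

Let Cinfty_nbhs_singleton f (A : set C) : nbhs f A -> A f.
Proof. by move=> [n [e [e0]]]; apply; rewrite /= subrr seminorm0. Qed.

Let Cinfty_nbhs_nbhs f (A : set C) : nbhs f A -> nbhs f (nbhs^~ A).
Proof.
move=> [n [e [e0 nA]]]; exists n, e; split=> // g /= ge.
exists n, (e - seminorm n (g - f)); split; first by rewrite subr_gt0.
move=> h /=; rewrite ltrBrDr => hg; apply: nA => /=.
apply: le_lt_trans hg; rewrite -[h - f](subrKA g).
exact: seminormD.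
Qed.

HB.instance Definition _ := Nbhs_isNbhsTopological.Build C
  Cinfty_nbhs_filter Cinfty_nbhs_singleton Cinfty_nbhs_nbhs.
End Cinfty_topology.

(* The ideals of a commutative unital ring; the whole ring is allowed. *)
Definition is_ideal (A : comNzRingType) (I : set A) : Prop :=
  [/\ I 0,
      forall x y, I x -> I y -> I (x + y)
    & forall a x, I x -> I (a * x)].

(* Property (Omega) for the subspace E of X, equipped with the restrictions to E
   of the seminorms p n. *)
Definition Omega (R : realType) (X : zmodType) (p : nat -> X -> R)
    (E : set X) : Prop :=
  forall n : nat, exists2 m : nat, (n <= m)%N &
  forall k : nat, (m <= k)%N -> exists (s : nat) (c : R), 0 < c /\
  forall (e : R) (x : X), 0 < e -> E x -> p m x <= 1 ->
  exists y : X, [/\ E y, p n (x - y) <= e & p k y <= c * e ^- s].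

(* Main.v *)
(* Let [f] be in the ideal with [seminorm (2n+2) f <= 1], and let [J] be an
   interval of length [2d]. Extract common zeros in [J] of the ideal, with
   multiplicity, one at a time. Either [n+2] of them are found, or after at most
   [n+1] extractions the remaining quotient ideal has no common zero in [J], and
   then every bump supported in [J] times the polynomial [w] of the extracted
   zeros is in the ideal. Write [f = w q], expand [q] by Taylor's formula at the
   centre of [J] so that [n+2] linear factors come out in total, and let [P] be
   [w] times the Taylor polynomial ([0] in the first case). Then bumps times [P]
   are in the ideal, the derivatives of [P] are bounded independently of [f] and
   [J], and the [j]-th derivative of [f - P] is [O(d^(n+2-j))] on [J]. Gluing the
   [P]s by a partition of unity at scale [d = 1/N] yields [y] with error [O(1/N)]
   in the [n]-th seminorm and [k]-th seminorm [O(N^(k+1))]; then take [N] of order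
   [1/e]. *)
Require Import Defs.
From HB Require Import structures.
From mathcomp Require Import all_boot all_order all_algebra.
From mathcomp Require Import complex.
From mathcomp Require Import all_classical all_reals.
From mathcomp Require Import interval_inference topology normedtype derive.
From mathcomp Require Import sequences realfun exp.
From mathcomp Require Import ring lra.
From mathcomp Require finmap.
Set Implicit Arguments.
Unset Strict Implicit.
Unset Printing Implicit Defensive.
Import Order.TTheory GRing.Theory Num.Theory.
Import numFieldNormedType.Exports.
Local Open Scope classical_set_scope.
Local Open Scope ring_scope.

(** * Derivatives by estimates, and the mean value inequality *)

Section derive_epsilon_delta.
Variables (R : realType) (K : normedModType R).
Implicit Types (f : R -> K) (x a b : R).

(** Clearing the denominator of the difference quotient leaves an inequality that also makes sense
    at [h = 0] and combines easily with norm bounds. *)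
Lemma is_derive1P f x (d : K) :
  is_derive x 1 f d <->
  forall e : R, 0 < e -> exists2 r : R, 0 < r &
    forall h, `|h| < r -> `|f (x + h) - f x - h *: d| <= e * `|h|.
Proof.
have quotE (h : R) : h != 0 ->
    `|h^-1 *: (f (h *: 1 + x) - f x) - d| =
    `|f (x + h) - f x - h *: d| / `|h|.
  move=> h0; rewrite /GRing.scale/= mulr1 [h + x]addrC.
  rewrite -{1}(scalerK h0 d) -scalerBr normrZ normfV mulrC//.
split=> [[fd dE] e e0|H].
  have /cvgrPdist_le/(_ e e0) : h^-1 *: (f (h *: 1 + x) - f x) @[h --> 0^'] -->
      d by rewrite -dE; exact: fd.
  move=> /nbhs_ballP[r /= r0 Hr].
  exists r => // h hr; have [->|h0] := eqVneq h 0.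
    by rewrite addr0 scale0r subr0 subrr normr0 normr0 mulr0.
  have := Hr h; rewrite /ball/= sub0r normrN => /(_ hr h0).
  by rewrite distrC quotE// ler_pdivrMr// normr_gt0.
have cv : h^-1 *: (f (h *: 1 + x) - f x) @[h --> 0^'] --> d.
  apply/cvgrPdist_le => e e0; have [r r0 Hr] := H e e0.
  apply/nbhs_ballP; exists r => //= h.
  rewrite /ball/= sub0r normrN => hr h0.
  by rewrite distrC quotE// ler_pdivrMr ?normr_gt0// Hr.
apply: DeriveDef; first by apply/cvg_ex; exists d.
exact/cvg_lim.
Qed.

Lemma is_derive1_continuous f x (d : K) :
  is_derive x 1 f d -> {for x, continuous f}.
Proof. by case=> fd _; apply/differentiable_continuous/derivable1_diffP. Qed.

(* [K] may be complex, so Rolle's theorem is not available: the set of [x] at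
   which the bound holds with [M + e] is closed and cannot have a maximum
   before [b]. *)
Lemma mean_value_inequality f (df : R -> K) a b (M : R) : a <= b ->
  (forall x, is_derive x 1 f (df x)) ->
  (forall x, a <= x <= b -> `|df x| <= M) ->
  `|f b - f a| <= M * (b - a).
Proof.
move=> ab fd dfM; apply/ler_addgt0Pr => e' e'0.
have ba1 : 0 < b - a + 1 by rewrite ltr_wpDl ?subr_ge0.
(* Over the whole interval the slack [e] adds up to at most [e']; the [+ 1] covers [a = b]. *)
pose e := e' / (b - a + 1); have e0 : 0 < e by rewrite divr_gt0.
pose A := `[a, b]%classic `&` [set x | `|f x - f a| - (M + e) * (x - a) <= 0].
have Aa : A a by split; rewrite /= ?in_itv/= ?lexx ?ab// !subrr normr0 mulr0 subr0.
have fc : continuous f by move=> x; exact: is_derive1_continuous (fd x).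
have Acl : closed A.
  apply: closedI; first exact: interval_closed.
  apply: (@preimage_closed _ _ (fun x => `|f x - f a| - (M + e) * (x - a))
    [set y | y <= 0]); last exact: closed_le.
  move=> x _; apply: cvgB; first by
    apply: cvg_norm; apply: cvgB => //; [exact: fc|exact: cvg_cst].
  by apply: cvgM; [exact: cvg_cst|apply: cvgB => //; exact: cvg_cst].
have Aub : has_ubound A by exists b => x [/=]; rewrite in_itv/= => /andP[].
have Ac : A (sup A) by apply: Acl; apply: closure_sup => //; exists a.
have M0 : 0 <= M by rewrite (le_trans _ (dfM a _))// lexx.
set c := sup A in Ac; case: Ac => /=; rewrite in_itv/= => /andP[ac cb] Pc.
have cE : c = b.
  apply/eqP; rewrite eq_le cb leNgt; apply/negP => ltcb.
  have [r r0 Hr] := (is_derive1P _ _ _).1 (fd c) e e0.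
  pose h := Num.min (r / 2) (b - c).
  have h0 : 0 < h by rewrite lt_min divr_gt0//= subr_gt0.
  have hr : `|h| < r.
    rewrite gtr0_norm// (@le_lt_trans _ _ (r / 2))//; first by rewrite ge_min lexx.
    by rewrite ltr_pdivrMr// ltr_pMr// ltr1n.
  have hb : c + h <= b by rewrite -lerBrDl ge_min lexx orbT.
  have : A (c + h).
    split; first by rewrite /= in_itv/= hb (le_trans ac)//= lerDl ltW.
    rewrite /= subr_le0.
    have -> : f (c + h) - f a =
      (f (c + h) - f c - h *: df c) + h *: df c + (f c - f a).
      by rewrite subrK addrA subrK.
    rewrite (le_trans (ler_normD _ _))// (_ : c + h - a = h + (c - a)); last by ring.
    rewrite mulrDr lerD//; last by rewrite -subr_le0.
    rewrite (le_trans (ler_normD _ _))// mulrDl addrC lerD//.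
      by rewrite normrZ gtr0_norm// mulrC ler_wpM2r// ?(ltW h0)// dfM// ac.
    by have := Hr h hr; rewrite (gtr0_norm h0).
  move=> /(ub_le_sup Aub); rewrite -/c -[leRHS]addr0 lerD2l leNgt h0//.
move: Pc; rewrite cE subr_le0 => /le_trans; apply.
rewrite mulrDl lerD2l// /e mulrAC ler_pdivrMr// ler_wpM2l//; first exact: ltW.
by rewrite lerDl.
Qed.

End derive_epsilon_delta.

(** * Smoothness through stable families, and points between two others *)

Section smooth_functions.
Variables (R : realType) (K : normedModType R).
Implicit Types (f g : R -> K) (a b x : R).

Lemma mean_value_inequality_between (f df : R -> K) (a b M : R) :
  (forall x : R, is_derive x 1 f (df x)) ->
  (forall x, Num.min a b <= x <= Num.max a b -> `|df x| <= M) ->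
  `|f b - f a| <= M * `|b - a|.
Proof.
move=> fd dfM; have [ab|ba] := leP a b.
  rewrite ger0_norm ?subr_ge0//; apply: (mean_value_inequality ab fd) => x axb.
  by apply: dfM; rewrite min_l// max_r.
rewrite distrC [`|b - a|]distrC ger0_norm ?subr_ge0 ?(ltW ba)//.
apply: (mean_value_inequality (ltW ba) fd) => x axb.
by apply: dfM; rewrite min_r ?(ltW ba)// max_l// ltW.
Qed.

Lemma between_dist (a b x : R) :
  Num.min a b <= x <= Num.max a b -> `|x - a| <= `|b - a|.
Proof.
have [ab|ba] := leP a b => /andP[h1 h2].
  by rewrite !ger0_norm ?subr_ge0// lerD2r.
by rewrite !ler0_norm ?subr_le0 ?(ltW ba)// lerN2 lerD2r.
Qed.

Lemma between_ball (a b x c d : R) : `|a - c| <= d -> `|b - c| <= d ->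
  Num.min a b <= x <= Num.max a b -> `|x - c| <= d.
Proof.
rewrite !ler_norml => /andP[a1 a2] /andP[b1 b2] /andP[x1 x2].
move: x1 x2; rewrite ge_min le_max => /orP[x1|x1] /orP[x2|x2]; apply/andP; split; lra.
Qed.

Lemma derive1_eq (f g : R -> K) :
  (forall x : R, is_derive x 1 f (g x)) -> derive1 f = g.
Proof. by move=> fd; apply/funext => x; rewrite derive1E; case: (fd x). Qed.

Lemma smooth_is_derive (f : R -> K) x : smooth f -> is_derive x 1 f (derive1 f x).
Proof. by move=> sf; rewrite derive1E; apply/derivableP/smooth_derivable. Qed.

Lemma smooth_continuous (f : R -> K) : smooth f -> continuous f.
Proof. by move=> sf x; exact: is_derive1_continuous (smooth_is_derive x sf). Qed.

(** The main tool for smoothness below: a function is placed in a family of explicit formulas closed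
    under derivation. *)
Lemma smooth_stable (S : set (R -> K)) :
  (forall f, S f -> exists2 g, S g & forall x : R, is_derive x 1 f (g x)) ->
  forall f, S f -> smooth f.
Proof.
move=> HS; apply: smooth_class => f /HS[g Sg fg]; split; last by rewrite (derive1_eq fg).
by move=> x; case: (fg x).
Qed.

End smooth_functions.

(** * Multiples of a fixed vector, finite sums, locality of derivatives *)

Section vector_scaling.
Variables (R : realType) (K : normedModType R).
Implicit Types (f g : R -> K) (a b x : R).

Lemma is_derive_scalev (p : R -> R) (x dp : R) (k : K) :
  is_derive x 1 p dp -> is_derive x 1 (fun y => p y *: k) (dp *: k).
Proof.
move=> pd; apply/is_derive1P => e e0.
have k1 : 0 < `|k| + 1 by rewrite ltr_wpDl.
have [r r0 Hr] := (is_derive1P _ _ _).1 pd (e / (`|k| + 1)) (divr_gt0 e0 k1).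
exists r => // h /Hr hh; rewrite scalerA -!scalerBl normrZ.
apply: (@le_trans _ _ (e / (`|k| + 1) * `|h| * `|k|)); first exact: ler_wpM2r.
rewrite mulrAC ler_wpM2r// mulrAC ler_pdivrMr// ler_wpM2l ?(ltW e0)//.
by rewrite lerDl.
Qed.

Lemma smooth_scalev (p : R -> R) (k : K) : smooth p -> smooth (fun x => p x *: k).
Proof.
move=> sp; apply: (@smooth_stable R K
  [set f | exists2 p : R -> R, smooth p & f = fun x => p x *: k]); last by exists p.
move=> _ [q sq ->]; exists (fun x => derive1 q x *: k).
  by exists (derive1 q); [exact: smooth_derive1|].
by move=> x; apply: is_derive_scalev; exact: smooth_is_derive.
Qed.

Lemma smooth_sum (I : Type) (s : seq I) (F : I -> R -> K) :
  (forall i, smooth (F i)) -> smooth (fun x => \sum_(i <- s) F i x).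
Proof.
move=> sF; elim: s => [|i s IH].
  rewrite (_ : (fun _ => _) = cst 0); first exact: smooth_cst.
  by apply/funext => x; rewrite big_nil.
rewrite (_ : (fun x => _) = F i + (fun x => \sum_(i <- s) F i x)).
  by apply: smoothD; [exact: sF|exact: IH].
by apply/funext => x; rewrite big_cons.
Qed.

Lemma derive1n_open_eq (U : set R) f g : open U ->
  (forall x, U x -> f x = g x) -> forall j x, U x -> derive1n j f x = derive1n j g x.
Proof.
move=> oU fg; elim=> [//|j IH] x Ux; rewrite !derive1nS !derive1E.
apply: near_eq_derive.
by apply: filterS (open_nbhs_nbhs (conj oU Ux)) => y; exact: IH.
Qed.

Lemma derive1n_cst0 j (v : K) x : derive1n j.+1 (cst v : R -> K) x = 0.
Proof.
have -> : derive1n j.+1 (cst v : R -> K) = cst 0; last by [].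
elim: j => [|j IH]; first by apply/funext => y; rewrite /= derive1_cst.
by rewrite derive1nS IH; apply/funext => y; rewrite derive1_cst.
Qed.

Lemma derive1n_open0 (U : set R) f : open U ->
  (forall x, U x -> f x = 0) -> forall j x, U x -> derive1n j f x = 0.
Proof.
move=> oU f0 j x Ux; rewrite (@derive1n_open_eq U f (cst 0) oU f0 _ _ Ux).
by case: j => [//|j]; exact: derive1n_cst0.
Qed.

Lemma derive1n_sum (I : Type) (s : seq I) (F : I -> R -> K) j x :
  (forall i, smooth (F i)) ->
  derive1n j (fun y => \sum_(i <- s) F i y) x = \sum_(i <- s) derive1n j (F i) x.
Proof.
move=> sF; elim: s => [|i s IH].
  rewrite big_nil (_ : (fun y => _) = cst 0).
    by case: j => [//|j]; exact: derive1n_cst0.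
  by apply/funext => y; rewrite big_nil.
rewrite big_cons -IH (_ : (fun y => _) = F i + (fun y => \sum_(i <- s) F i y)).
  by rewrite derive1nD//; exact: smooth_sum.
by apply/funext => y; rewrite big_cons.
Qed.

End vector_scaling.

(** * Products of a real function with an algebra-valued one *)

Section scale.
Variables (R : realType) (K : normedComAlgType R).
Implicit Types (p : R -> R) (f : R -> K) (x : R).

Lemma amul_scale1 (l : R) (k : K) : amul (l *: aone) k = l *: k.
Proof. by rewrite -ascaleAl amul1. Qed.

(** Scaling by [p y] is multiplication by [p y *: aone], so the product rule for [amul] applies. *)
Lemma is_derive_scale p f x (dp : R) (df : K) :
  is_derive x 1 p dp -> is_derive x 1 f df ->
  is_derive x 1 (fun y => p y *: f y) (dp *: f x + p x *: df).
Proof.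
move=> pd fd.
have := is_derive_amul (is_derive_scalev (aone : K) pd) fd.
rewrite !amul_scale1 (_ : (fun y => _) = (fun y => p y *: f y))//.
by apply/funext => y; rewrite amul_scale1.
Qed.

Lemma smooth_scale p f : smooth p -> smooth f -> smooth (fun x => p x *: f x).
Proof.
move=> sp sf; have := smooth_amul (@smooth_scalev R K p aone sp) sf.
rewrite (_ : (fun y => _) = (fun y => p y *: f y))//.
by apply/funext => y; rewrite amul_scale1.
Qed.

Lemma derive1_scale p f : smooth p -> smooth f ->
  derive1 (fun x => p x *: f x) =
  (fun x => derive1 p x *: f x) + (fun x => p x *: derive1 f x).
Proof.
move=> sp sf; apply: derive1_eq => x.
by apply: is_derive_scale; exact: smooth_is_derive.
Qed.

End scale.

(** * Weighted bounds on derivatives and Leibniz's rule *)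

Section derivs_le.
Variables (R : realType).

(** The weight [d ^+ i] compensates rescaling to length [d]: a cutoff of width [d] has bounds
    independent of [d]. *)
Definition derivs_le (K : normedModType R) (k : nat) (d B : R) (f : R -> K) (x : R) :=
  forall i, (i <= k)%N -> d ^+ i * `|derive1n i f x| <= B.

Lemma derivs_leD (K : normedModType R) k d A B (f g : R -> K) x : 0 <= d ->
  smooth f -> smooth g ->
  derivs_le k d A f x -> derivs_le k d B g x -> derivs_le k d (A + B) (f + g) x.
Proof.
move=> d0 sf sg fA gB i ik; rewrite derive1nD//.
apply: le_trans (lerD (fA i ik) (gB i ik)).
by rewrite -mulrDr ler_wpM2l ?exprn_ge0// ler_normD.
Qed.

Lemma derivs_le_ge0 (K : normedModType R) k d B (f : R -> K) x :
  derivs_le k d B f x -> 0 <= B.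
Proof. by move=> /(_ 0%N isT); apply: le_trans; rewrite expr0 mul1r normr_ge0. Qed.

Variable K : normedComAlgType R.

(** The power of 2 is the sum of the binomial coefficients in Leibniz's rule; it arises by
    induction, as each derivative splits one product into two. *)
Lemma scale_derivs_le k d A B (p : R -> R) (f : R -> K) x : 0 < d ->
  smooth p -> smooth f ->
  derivs_le k d A p x -> derivs_le k d B f x ->
  derivs_le k d (2 ^+ k * A * B) (fun y => p y *: f y) x.
Proof.
move=> d0 sp sf pA fB i ik.
have AB0 : 0 <= A * B by rewrite mulr_ge0// ?(derivs_le_ge0 pA)// (derivs_le_ge0 fB).
(* Only orders up to [i] matter, so the hypotheses are cut down to [i] and the induction runs on
   [i]. *)
apply: (@le_trans _ _ (2 ^+ i * A * B)); last first.
  by rewrite -!mulrA ler_wpM2r// ler_weXn2l// ler1n.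
have {}pA : derivs_le i d A p x by move=> j ji; apply: pA; exact: leq_trans ik.
have {}fB : derivs_le i d B f x by move=> j ji; apply: fB; exact: leq_trans ik.
clear AB0 ik; elim: i A B p f sp sf pA fB => [|i IH] A B p f sp sf pA fB.
  rewrite !expr0 !mul1r normrZ ler_pM//.
    by have := pA 0%N isT; rewrite expr0 mul1r.
  by have := fB 0%N isT; rewrite expr0 mul1r.
(* Passing to the derivative costs [1 / d], which the additional weight [d] of order [i.+1]
   repays. *)
have shift (L : normedModType R) C (g : R -> L) :
    derivs_le i.+1 d C g x -> derivs_le i d (C / d) (derive1 g) x.
  move=> gC j ji; rewrite ler_pdivlMr// mulrAC -exprSr -derive1Sn.
  exact: gC.
have low (L : normedModType R) C (g : R -> L) :
    derivs_le i.+1 d C g x -> derivs_le i d C g x.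
  by move=> gC j ji; apply: gC; rewrite (leq_trans ji).
have sp' := smooth_derive1 sp; have sf' := smooth_derive1 sf.
rewrite derive1Sn derive1_scale// derive1nD; [|exact: smooth_scale..].
apply: (@le_trans _ _ (d * (2 ^+ i * (A / d) * B + 2 ^+ i * A * (B / d)))).
  rewrite exprS -mulrA ler_wpM2l ?(ltW d0)//.
  apply: le_trans (lerD (IH _ _ _ _ sp' sf (shift _ _ _ pA) (low _ _ _ fB))
                        (IH _ _ _ _ sp sf' (low _ _ _ pA) (shift _ _ _ fB))).
  by rewrite -mulrDr ler_wpM2l ?exprn_ge0 ?(ltW d0)// ler_normD.
rewrite le_eqVlt; apply/orP; left; apply/eqP; rewrite exprS.
by field; rewrite gt_eqF.
Qed.

End derivs_le.

(** * Hadamard's lemma with bounds on all derivatives *)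

Section hadamard.
Variables (R : realType) (K : normedComAlgType R).
Implicit Types (f g q : R -> K) (a x : R).

(* The defining relation of [q x = \int_0^1 t ^+ k *: f (a + t (x - a)) dt]. *)
Definition weighted_mean a k f q :=
  [/\ smooth f, q a = k.+1%:R^-1 *: f a &
    forall x : R,
    is_derive x 1 (fun y => (y - a) ^+ k.+1 *: q y) ((x - a) ^+ k *: f x)].

Lemma is_derive_pow_sub a k x :
  is_derive x 1 (fun y : R => (y - a) ^+ k.+1) (k.+1%:R * (x - a) ^+ k).
Proof.
have xd : is_derive x 1 (fun y : R => y - a) 1.
  have := is_deriveB (is_derive_id (x : R) (1 : R)) (is_derive_cst a (x : R) (1 : R)).
  by rewrite subr0.
have := is_deriveX k.+1 xd.
by rewrite exprfctE /GRing.scale/= mulr1.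
Qed.

(** For [x] other than [a], apply the mean value inequality to [(y - a) ^+ k.+1 *: q y], which
    vanishes at [a], and divide by the power of [x - a]. *)
Lemma weighted_mean_bound a k f q M x : weighted_mean a k f q ->
  (forall y, Num.min a x <= y <= Num.max a x -> `|f y| <= M) -> `|q x| <= M.
Proof.
move=> [sf qa qd] fM.
have [<-|xa] := eqVneq a x.
  rewrite qa normrZ; apply: le_trans (fM a _); last by rewrite ge_min le_max lexx.
  by rewrite ler_piMl// ger0_norm ?invr_ge0// invf_le1// ler1n.
have xa0 : 0 < `|x - a| by rewrite normr_gt0 subr_eq0 eq_sym.
have := @mean_value_inequality_between _ _ _ _ a x (`|x - a| ^+ k * M) qd.
rewrite subrr expr0n/= scale0r subr0 normrZ normrX => H.
rewrite -(ler_pM2l (exprn_gt0 k.+1 xa0)) [leRHS]mulrC exprSr mulrCA mulrA.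
rewrite [`|x - a| ^+ k * M]mulrC in H *; rewrite -exprSr.
apply: H => y ayx; rewrite normrZ normrX mulrC ler_pM ?exprn_ge0// ?fM//.
by rewrite lerXn2r ?nnegrE//; exact: between_dist.
Qed.

(** Differentiating under the integral sign brings out one more factor [t], hence the weight [k.+1]
    and the integrand [derive1 f]. *)
Lemma weighted_mean_derive a k f q : weighted_mean a k f q ->
  exists2 q', weighted_mean a k.+1 (derive1 f) q' &
    forall x : R, is_derive x 1 q (q' x).
Proof.
move=> [sf qa qd].
(* Expanding the defining relation gives [k.+1%:R *: q x + (x - a) *: q' x = f x]; the value at [a]
   is the one a weighted mean must have. *)
pose q' x := if x == a then k.+2%:R^-1 *: derive1 f a
             else (x - a)^-1 *: (f x - k.+1%:R *: q x).
have kn0 j : j.+1%:R != 0 :> R by rewrite pnatr_eq0.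
exists q'.
  split; first exact: smooth_derive1.
    by rewrite /q' eqxx.
  move=> x.
  rewrite (_ : (fun y => _) =
    (fun y => (y - a) ^+ k.+1 *: f y) -
    k.+1%:R *: (fun y => (y - a) ^+ k.+1 *: q y)); last first.
    apply/funext => y; rewrite /q' -[RHS]/(_ *: _ - k.+1%:R *: (_ *: _)).
    have [->|ya] := eqVneq y a; first by rewrite subrr !expr0n/= !scale0r scaler0 subrr.
    rewrite [LHS]scalerA (exprSr _ k.+1) mulfK ?subr_eq0//.
    by rewrite scalerBr !scalerA mulrC.
  have D := is_deriveB
    (is_derive_scale (is_derive_pow_sub a k x) (smooth_is_derive x sf))
    (is_deriveZ k.+1%:R (qd x)).
  suff <- : (k.+1%:R * (x - a) ^+ k) *: f x + (x - a) ^+ k.+1 *: derive1 f x -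
     k.+1%:R *: ((x - a) ^+ k *: f x) = (x - a) ^+ k.+1 *: derive1 f x.
    exact: D.
  by rewrite scalerA addrAC subrr add0r.
move=> x; have [->|xa] := eqVneq x a; last first.
  have xa0 : x - a != 0 by rewrite subr_eq0.
  have Vd : is_derive x 1 (fun y : R => ((y - a) ^+ k.+1)^-1)
      (- ((x - a) ^+ k.+1) ^- 2 *: (k.+1%:R * (x - a) ^+ k)).
    have pd := is_derive_pow_sub a k x.
    by apply: is_deriveV; rewrite expf_neq0.
  apply: (@near_eq_is_derive _ _ _
    (fun y => ((y - a) ^+ k.+1)^-1 *: ((y - a) ^+ k.+1 *: q y))).
    apply: filterS (open_nbhs_nbhs (conj (@open_neq R a) xa)) => y /= ya.
    by rewrite scalerA mulVf ?scale1r// expf_neq0// subr_eq0.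
  suff -> : q' x = - ((x - a) ^+ k.+1) ^- 2 *: (k.+1%:R * (x - a) ^+ k) *:
      ((x - a) ^+ k.+1 *: q x) + ((x - a) ^+ k.+1)^-1 *: ((x - a) ^+ k *: f x).
    exact: (is_derive_scale Vd (qd x)).
  rewrite /q' (negbTE xa) scalerBr !scalerA addrC; congr (_ + _).
    rewrite -scaleNr; congr (_ *: _); rewrite /GRing.scale/= !(exprS _ k).
    have := expf_neq0 k xa0; move: xa0.
    move: ((x - a) ^+ k) (x - a) => p u u0 p0.
    by field; rewrite p0 u0.
  by congr (_ *: _); rewrite exprS invfM -mulrA mulVf ?mulr1// expf_neq0//.
rewrite /q' eqxx.
set q1 := k.+2%:R^-1 *: _.
(* [H] is the first-order error of [q] at [a] times [(y - a) ^+ k.+1]. Its derivative is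
   [(y - a) ^+ k] times the first-order error of [f], which is small, so the mean value inequality
   bounds [H]. *)
pose H y := (y - a) ^+ k.+1 *: q y - (y - a) ^+ k.+1 *: q a - (y - a) ^+ k.+2 *: q1.
have Hd (y : R) : is_derive y 1 H
    ((y - a) ^+ k *: (f y - f a - (y - a) *: derive1 f a)).
  suff -> : (y - a) ^+ k *: (f y - f a - (y - a) *: derive1 f a) =
      (y - a) ^+ k *: f y - (k.+1%:R * (y - a) ^+ k) *: q a -
      (k.+2%:R * (y - a) ^+ k.+1) *: q1.
    exact: (is_deriveB (is_deriveB (qd y)
      (is_derive_scalev (q a) (is_derive_pow_sub a k y)))
      (is_derive_scalev q1 (is_derive_pow_sub a k.+1 y))).
  rewrite qa /q1 !scalerBr !scalerA; congr (_ - _ *: _ - _ *: _).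
    by rewrite mulrAC divff// mul1r.
  by rewrite mulrAC divff// mul1r exprSr.
apply/is_derive1P => e e0.
have [r r0 Hr] := (is_derive1P _ _ _).1 (smooth_is_derive a sf) e e0.
exists r => // h hr; have [->|h0] := eqVneq h 0.
  by rewrite addr0 scale0r subr0 subrr !normr0 mulr0.
have nh0 : 0 < `|h| by rewrite normr_gt0.
have ahE : a + h - a = h by rewrite addrAC subrr add0r.
have := @mean_value_inequality_between _ _ _ _ a (a + h) (`|h| ^+ k * (e * `|h|)) Hd.
rewrite /H ahE !subrr !expr0n/= !scale0r !subr0.
rewrite (exprSr h k.+1) -scalerA -!scalerBr normrZ normrX => Hb.
rewrite -(ler_pM2l (exprn_gt0 k.+1 nh0)).
rewrite [leRHS](_ : _ = `|h| ^+ k * (e * `|h|) * `|h|); last first.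
  by rewrite exprSr mulrAC.
apply: Hb => y ahy.
have yh : `|y - a| <= `|h| by rewrite -[in leRHS]ahE; exact: between_dist.
rewrite normrZ normrX ler_pM ?exprn_ge0// ?lerXn2r ?nnegrE//.
have := Hr (y - a); rewrite [a + _]addrC subrK => /(_ (le_lt_trans yh hr)).
move=> /le_trans; apply.
by rewrite ler_wpM2l// ltW.
Qed.

(** The weighted means for all [k] and [f] together are stable under derivation. *)
Lemma weighted_mean_smooth a k f q : weighted_mean a k f q -> smooth q.
Proof.
move=> w; apply: (@smooth_stable R K
  [set g | exists k f, weighted_mean a k f g]); last by exists k, f.
move=> g [j [h /weighted_mean_derive[g' wg' gd]]]; exists g' => //.
by exists j.+1, (derive1 h).
Qed.

Lemma weighted_mean_derive1n a k f q j : weighted_mean a k f q ->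
  weighted_mean a (k + j) (derive1n j f) (derive1n j q).
Proof.
move=> w; elim: j => [|j]; first by rewrite addn0.
move=> /weighted_mean_derive[g' wg' gd].
by rewrite addnS !derive1nS (derive1_eq gd).
Qed.

(** The quotient is the weighted mean of [derive1 g] with [k = 0]. Its [j]-th derivative is a
    weighted mean of the derivative of order [j.+1] over the segment from [a] to [x], so no constant
    is lost. *)
Lemma hadamard g a : smooth g -> exists q,
  [/\ smooth q, forall x, g x = g a + (x - a) *: q x &
    forall j M x,
      (forall y, Num.min a x <= y <= Num.max a x -> `|derive1n j.+1 g y| <= M) ->
      `|derive1n j q x| <= M].
Proof.
move=> sg.
pose q x := if x == a then derive1 g a else (x - a)^-1 *: (g x - g a).
have gE x : g x = g a + (x - a) *: q x.
  rewrite /q; have [->|xa] := eqVneq x a; first by rewrite subrr scale0r addr0.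
  by rewrite scalerA divff ?subr_eq0// scale1r addrC subrK.
have w : weighted_mean a 0 (derive1 g) q.
  split; first exact: smooth_derive1.
    by rewrite /q eqxx invr1 scale1r.
  move=> x; rewrite (_ : (fun y => _) = g - cst (g a)); last first.
    by apply/funext => y; rewrite -[RHS]/(g y - g a) [g y]gE expr1 [RHS]addrC addKr.
  rewrite expr0 scale1r -[derive1 g x]subr0.
  exact: (is_deriveB (smooth_is_derive x sg) (is_derive_cst (g a) x 1)).
exists q; split=> //; first exact: weighted_mean_smooth w.
move=> j M x gM; apply: (weighted_mean_bound (weighted_mean_derive1n j w)) => y ayx.
by rewrite -derive1Sn; exact: gM.
Qed.

End hadamard.

(** * Smooth cutoffs and partitions of unity on the line *)

Section real_smooth.
Variable R : realType.
Implicit Types (f g u : R -> R) (x : R).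

Lemma smoothM f g : smooth f -> smooth g -> smooth (fun x => f x * g x).
Proof. by move=> sf sg; exact: (smooth_scale sf sg). Qed.

Lemma is_derive_affine (c b x : R) : is_derive x 1 (fun y : R => c * y + b) c.
Proof.
have := is_deriveD (is_deriveZ c (is_derive_id (x : R) (1 : R)))
                   (is_derive_cst b (x : R) (1 : R)).
by rewrite addr0 /GRing.scale/= mulr1.
Qed.

Lemma is_derive_comp_affine f (c b x df : R) : is_derive (c * x + b) 1 f df ->
  is_derive x 1 (fun y => f (c * y + b)) (c * df).
Proof.
move=> fd; rewrite mulrC.
exact: (@is_derive1_comp R f (fun y => c * y + b) x df c fd (is_derive_affine c b x)).
Qed.

Lemma smooth_comp_affine f (c b : R) : smooth f -> smooth (fun x => f (c * x + b)).
Proof.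
move=> sf; apply: (@smooth_stable R R [set g | exists (l : R) (h : R -> R),
  smooth h /\ g = fun x => l * h (c * x + b)]); last first.
  by exists 1, f; split=> //; apply/funext => x; rewrite mul1r.
move=> g [l [h [sh ->]]]; exists (fun x => l * c * derive1 h (c * x + b)).
  by exists (l * c), (derive1 h); split; [exact: smooth_derive1|].
move=> x; rewrite -mulrA; apply: is_deriveZ; apply: is_derive_comp_affine.
exact: smooth_is_derive.
Qed.

Lemma derive1n_comp_affine f (c b : R) j x : smooth f ->
  derive1n j (fun x => f (c * x + b)) x = c ^+ j * derive1n j f (c * x + b).
Proof.
move=> sf; elim: j x => [|j IH] x; first by rewrite expr0 mul1r.
rewrite !derive1nS (_ : derive1n j _ =
  fun x => c ^+ j * derive1n j f (c * x + b)); last exact/funext.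
rewrite exprSr -mulrA derive1E; apply: derive_val; apply: is_deriveZ.
by apply: is_derive_comp_affine; apply: smooth_is_derive; exact: smooth_derive1n.
Qed.

(** The quotients [h x / u x ^+ k] with [h] smooth form a stable family. *)
Lemma smooth_inv u : smooth u -> (forall x, u x != 0) -> smooth (fun x => (u x)^-1).
Proof.
move=> su u0; apply: (@smooth_stable R R [set g | exists k (h : R -> R),
  smooth h /\ g = fun x => h x / u x ^+ k]); last first.
  exists 1%N, (cst 1); split; first exact: smooth_cst.
  by apply/funext => x; rewrite expr1 mul1r.
move=> g [k [h [sh ->]]].
exists (fun x => (derive1 h x * u x - k%:R * (h x * derive1 u x)) / u x ^+ k.+1).
  exists k.+1, (fun x => derive1 h x * u x - k%:R * (h x * derive1 u x)).
  split; last by [].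
  apply: smoothB; first by apply: smoothM su; exact: smooth_derive1.
  by apply: smoothZ; apply: smoothM sh _; exact: smooth_derive1.
move=> x.
have ukd : is_derive x 1 (fun y => u y ^+ k) (k%:R * u x ^+ k.-1 * derive1 u x).
  have := is_deriveX k (smooth_is_derive x su).
  by rewrite exprfctE.
have Vd := @is_deriveV R (fun y => u y ^+ k) x _ 1 (expf_neq0 k (u0 x)) ukd.
suff -> : (derive1 h x * u x - k%:R * (h x * derive1 u x)) / u x ^+ k.+1 =
   derive1 h x * (u x ^+ k)^-1 +
   h x * (- (u x ^+ k) ^- 2 * (k%:R * u x ^+ k.-1 * derive1 u x)).
  exact: (is_derive_scale (smooth_is_derive x sh) Vd).
case: k {ukd Vd} => [|k].
  by rewrite !mul0r subr0 !expr0 expr1 mulr0 mulr0 addr0 invr1 mulr1 mulfK.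
rewrite -pred_Sn !exprS; have := expf_neq0 k (u0 x); have := u0 x.
move: (u x ^+ k) (u x) => p v v0 p0.
by field; rewrite v0 p0.
Qed.

(** Coefficient by coefficient, since [y ^+ i] is at most [i]! times the exponential of [y]. *)
Lemma horner_expR_bounded (p : {poly R}) :
  exists C : R, forall y, 0 <= y -> `|p.[y]| * expR (- y) <= C.
Proof.
exists (\sum_(i < size p) `|p`_i| * i`!%:R) => y y0.
rewrite expRN ler_pdivrMr ?expR_gt0// horner_coef.
rewrite (le_trans (ler_norm_sum _ _ _))// big_distrl/=.
apply: ler_sum => i _; rewrite normrM normrX (ger0_norm y0) -mulrA ler_wpM2l//.
case: (val i) => [|n]; first by rewrite expr0 mul1r -expR0 ler_expR.
have f0 : 0 < n.+1`!%:R :> R by rewrite ltr0n fact_gt0.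
rewrite -ler_pdivrMl// mulrC; apply: le_trans (expR_ge1Dxn n y0).
by rewrite lerDr.
Qed.

(** The polynomial factor makes the family stable: derivation replaces [p] by X^2 (p - p'). *)
Definition flat_poly (p : {poly R}) x : R :=
  if 0 < x then p.[x^-1] * expR (- x^-1) else 0.

Lemma is_derive_flat_poly (p : {poly R}) x :
  is_derive x 1 (flat_poly p) (flat_poly ('X^2 * (p - p^`()%R)) x).
Proof.
have [x0|x0|->] := ltgtP x 0.
- rewrite [flat_poly _ x]/flat_poly ltNge (ltW x0)/=.
  apply: (@near_eq_is_derive _ _ _ (cst 0)).
  apply: filterS (open_nbhs_nbhs (conj (@open_lt R 0) x0)) => y /= y0.
  by rewrite /flat_poly ltNge (ltW y0).
- rewrite [flat_poly _ x]/flat_poly x0.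
  suff D : is_derive x 1 (fun y => p.[y^-1] * expR (- y^-1))
      (('X^2 * (p - p^`()%R)).[x^-1] * expR (- x^-1)).
    apply: (near_eq_is_derive _ D).
    apply: filterS (open_nbhs_nbhs (conj (@open_gt R 0) x0)) => y /= y0.
    by rewrite /flat_poly y0.
  have xn0 : x != 0 by rewrite gt_eqF.
  have Vd : is_derive x 1 (fun y : R => y^-1) (- x ^- 2 * 1).
    exact: (@is_deriveV R id x _ 1 xn0 (is_derive_id (x : R) (1 : R))).
  have pd := is_derive1_comp (is_derive_poly p x^-1) Vd.
  have Ed := @is_derive1_comp R expR (fun y : R => - y^-1) x _ _
    (is_derive_expR (- x^-1)) (is_deriveN Vd).
  suff -> : ('X^2 * (p - p^`()%R)).[x^-1] * expR (- x^-1) =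
     p^`()%R.[x^-1] * (- x ^- 2 * 1) * expR (- x^-1) +
     p.[x^-1] * (expR (- x^-1) * - (- x ^- 2 * 1)).
    exact: (is_derive_scale pd Ed).
  rewrite hornerM hornerD hornerN hornerXn exprVn.
  move: (x ^- 2) (expR _) (p.[_]) (p^`()%R.[_]) => v e y z.
  by rewrite mulr1; ring.
- rewrite [flat_poly _ 0]/flat_poly ltxx.
  (* The factor ['X^2] turns boundedness into the estimate [C * h ^+ 2] for the increment at 0, so
     the derivative there is 0. *)
  have [C HC] := horner_expR_bounded ('X^2 * p).
  have C0 : 0 <= C by apply: le_trans (HC 0 (lexx _)); rewrite mulr_ge0// expR_ge0.
  have C1 : 0 < C + 1 by rewrite ltr_wpDl.
  apply/is_derive1P => e e0; exists (e / (C + 1)); first by rewrite divr_gt0.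
  move=> h hr; rewrite add0r [flat_poly p 0]/flat_poly ltxx scaler0 !subr0.
  rewrite /flat_poly; case: ifP => [h0|_]; last by rewrite normr0 mulr_ge0// ltW.
  rewrite (gtr0_norm h0) in hr *.
  have hn0 : h != 0 by rewrite gt_eqF.
  have := HC h^-1; rewrite invr_ge0 => /(_ (ltW h0)).
  rewrite !hornerE normrM (@ger0_norm _ (h^-1 ^+ 2)) ?exprn_ge0 ?invr_ge0 ?(ltW h0)//.
  rewrite normrM (ger0_norm (expR_ge0 _)) -mulrA exprVn ler_pdivrMl ?exprn_gt0//.
  move=> /le_trans; apply.
  rewrite expr2 mulrAC ler_wpM2r ?(ltW h0)//.
  rewrite ltW// (le_lt_trans _ (y := h * (C + 1))) -?ltr_pdivlMr//.
  by rewrite ler_wpM2l ?(ltW h0)// lerDl.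
Qed.

Definition flat x : R := flat_poly 1 x.

Lemma flat_smooth : smooth flat.
Proof.
apply: (@smooth_stable R R [set g | exists p, g = flat_poly p]); last by exists 1.
move=> _ [p ->]; exists (flat_poly ('X^2 * (p - p^`()%R))).
  by exists ('X^2 * (p - p^`()%R)).
by move=> x; exact: is_derive_flat_poly.
Qed.

Lemma flat_gt0 x : (0 < flat x) = (0 < x).
Proof.
by rewrite /flat /flat_poly; case: ifP; rewrite ?ltxx// hornerC mul1r expR_gt0.
Qed.

Lemma flat_ge0 x : 0 <= flat x.
Proof.
by rewrite /flat /flat_poly; case: ifP => // _; rewrite hornerC mul1r expR_ge0.
Qed.

Lemma flat0 x : x <= 0 -> flat x = 0.
Proof. by rewrite /flat /flat_poly leNgt => /negbTE ->. Qed.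

(** Divide [flat x] by [flat x + flat (1 - x)], which is positive because [x] and [1 - x] are never
    both nonpositive. *)
Lemma smooth_step : exists s : R -> R,
  [/\ smooth s, forall x, x <= 0 -> s x = 0 & forall x, 1 <= x -> s x = 1].
Proof.
pose d x := flat x + flat (-1 * x + 1).
have d0 x : 0 < d x.
  rewrite /d; have [x0|x0] := ltP 0 x.
    by rewrite ltr_pwDl ?flat_gt0// flat_ge0.
  by rewrite ltr_wpDl ?flat_ge0// flat_gt0; lra.
have sd : smooth d.
  by apply: smoothD; [exact: flat_smooth|exact: smooth_comp_affine flat_smooth].
exists (fun x => flat x * (d x)^-1); split.
- apply: smoothM; first exact: flat_smooth.
  by apply: smooth_inv => // x; rewrite gt_eqF.
- by move=> x x0; rewrite flat0// mul0r.
- move=> x x1; have dE : d x = flat x by rewrite /d (@flat0 (-1 * x + 1)) ?addr0//; lra.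
  by rewrite dE divff// -dE gt_eqF.
Qed.

(** With a smooth step [s], the differences [s (x + 1) - s x] telescope over integer translates,
    leaving [s (z + 1) - s (z - L)]. *)
Lemma smooth_partition_of_unity : exists psi : R -> R, [/\ smooth psi,
  forall x, 1 <= `|x| -> psi x = 0 &
  forall (L : nat) z, 0 <= z <= L%:R -> \sum_(t < L.+1) psi (z - t%:R) = 1].
Proof.
have [s [ss s0 s1]] := smooth_step.
exists (fun x => s (1 * x + 1) - s x); split.
- by apply: smoothB; [exact: (smooth_comp_affine ss)|exact: ss].
- move=> x; rewrite ler_normr mul1r => /orP[x1|x1].
    by rewrite !s1 ?subrr//; lra.
  by rewrite !s0 ?subrr//; lra.
- move=> L z /andP[z0 zL].
  have -> M : \sum_(t < M) (s (1 * (z - t%:R) + 1) - s (z - t%:R)) =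
             s (z + 1) - s (z + 1 - M%:R).
    elim: M => [|M IH]; first by rewrite big_ord0 subr0 subrr.
    rewrite big_ord_recr/= IH mul1r (addrAC z _ 1) addrA subrK.
    by congr (_ - s _); rewrite -natr1; ring.
  by rewrite s1 ?s0 ?subr0// -?natr1; lra.
Qed.

Lemma derivs_bounded_of_support (psi : R -> R) k : smooth psi ->
  (forall x, 1 <= `|x| -> psi x = 0) ->
  exists A, forall j x, (j <= k)%N -> `|derive1n j psi x| <= A.
Proof.
(* The index is also a radius: [k.+1] covers the interval from -1 to 1 even when [k = 0]. *)
move=> sp p0; have [M HM] := smooth_bounded k.+1 sp.
exists M => j x jk.
have [x1|x1] := leP `|x| 1; first by rewrite HM ?(leqW jk)// (le_trans x1)// ler1n.
have oU : open [set y : R | 1 < `|y|].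
  apply: (@open_comp R R (@Num.norm R R) [set y | 1 < y]); last exact: open_gt.
  by move=> y _; exact: norm_continuous.
rewrite (derive1n_open0 oU)//.
  rewrite normr0 (le_trans (normr_ge0 _) (HM 0%N 0 _ _))// normr0//.
by move=> y /= y1; rewrite p0// ltW.
Qed.

End real_smooth.

(** * Ideals of smooth functions and extraction of common zeros *)

Section function_ideal.
Variables (R : realType) (K : normedComAlgType R).
Implicit Types (F : set (R -> K)) (f g q : R -> K) (s : seq R) (c d x : R).

(** Stated for plain functions, so that quotient ideals can be formed without bundling smoothness
    proofs. *)
Definition function_ideal F :=
  [/\ F `<=` @smooth R K, F (cst 0),
      forall f g, F f -> F g -> F (f + g)
    & forall a f, smooth a -> F f -> F (fun x => amul (a x) (f x))].

Lemma function_ideal_scale F (p : R -> R) f :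
  function_ideal F -> smooth p -> F f -> F (fun x => p x *: f x).
Proof.
move=> [_ _ _ FM] sp Ff; have := FM _ _ (@smooth_scalev R K p aone sp) Ff.
rewrite (_ : (fun x => _) = fun x => p x *: f x)//.
by apply/funext => x; rewrite amul_scale1.
Qed.

Lemma function_ideal_sum F (I : Type) (t : seq I) (G : I -> R -> K) :
  function_ideal F -> (forall i, F (G i)) -> F (fun x => \sum_(i <- t) G i x).
Proof.
move=> [_ F0 FD _] FG; elim: t => [|i t IH].
  by rewrite (_ : (fun x => _) = cst 0)//; apply/funext => x; rewrite big_nil.
rewrite (_ : (fun x => _) = G i + (fun x => \sum_(i <- t) G i x)).
  exact: FD.
by apply/funext => x; rewrite big_cons.
Qed.

(** A list is used because repetitions carry multiplicities. *)
Definition root_prod s x : R := \prod_(a <- s) (x - a).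

Lemma smooth_sub (a : R) : smooth (fun x : R => x - a).
Proof.
apply: (@smooth_stable R R [set g | exists c b : R, g = fun x => c * x + b]).
  move=> _ [c [b ->]]; exists (fun=> c).
    by exists 0, c; apply/funext => x; rewrite mul0r add0r.
  by move=> x; exact: is_derive_affine.
by exists 1, (- a); apply/funext => x; rewrite mul1r.
Qed.

Lemma root_prod_cons a s x : root_prod (a :: s) x = (x - a) * root_prod s x.
Proof. by rewrite /root_prod big_cons. Qed.

Lemma root_prod_nil x : root_prod [::] x = 1.
Proof. by rewrite /root_prod big_nil. Qed.

Lemma root_prod_cat s t x : root_prod (s ++ t) x = root_prod s x * root_prod t x.
Proof. by rewrite /root_prod big_cat. Qed.

Lemma smooth_root_prod s : smooth (root_prod s).
Proof.
elim: s => [|a s IH].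
  by rewrite (_ : root_prod _ = cst 1); [exact: smooth_cst|apply/funext/root_prod_nil].
rewrite (_ : root_prod _ = fun x => (x - a) * root_prod s x).
  exact: (smoothM (@smooth_sub a) IH).
by apply/funext => x; exact: root_prod_cons.
Qed.

(** Dividing by [size s] linear factors costs as many derivatives, but neither a constant nor a
    larger interval. *)
Definition bounded_quotient c d s g q :=
  [/\ smooth q, forall x, g x = root_prod s x *: q x &
    forall i M, (forall x, `|x - c| <= d -> `|derive1n (i + size s) g x| <= M) ->
      forall x, `|x - c| <= d -> `|derive1n i q x| <= M].

(* Satisfied by the conjugate [p] of [q], with [u = |q|^2]. *)
Definition locally_invertible := forall q a, smooth q -> q a != 0 ->
  exists (p : R -> K) (u : R -> R), [/\ smooth p, smooth u,
    forall x, amul (p x) (q x) = u x *: aone, forall x, 0 <= u x & 0 < u a].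

Hypothesis Kinv : locally_invertible.

(* The compact interval is covered by finitely many sets [0 < phi a] with
   [phi a *: aone] in [F]; their sum [u] is made invertible on the whole line
   by adding a function [theta] which vanishes on the interval only. *)
Lemma function_ideal_bump F c d : function_ideal F ->
  (forall a, `|a - c| <= d -> exists2 q, F q & q a != 0) ->
  forall chi : R -> R, smooth chi -> (forall x, d <= `|x - c| -> chi x = 0) ->
  F (fun x => chi x *: aone).
Proof.
move=> FI Fnz chi schi chi0; have [Fs F0 FD FM] := FI.
have /choice[phi phiP] a : exists u : R -> R, `|a - c| <= d ->
    [/\ smooth u, forall x, 0 <= u x, 0 < u a & F (fun x => u x *: aone)].
  have [ac|ac] := leP `|a - c| d; last by exists (cst 0).
  have [q Fq qa] := Fnz a ac; have [p [u [sp su pqu u0 ua]]] := Kinv (Fs _ Fq) qa.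
  exists u => _; split=> //; have := FM _ _ sp Fq.
  by rewrite (_ : (fun x => _) = fun x => u x *: aone)//; apply/funext.
pose J := [set a : R | `|a - c| <= d].
have Jc : compact J.
  rewrite (_ : J = `[c - d, c + d]%classic); first exact: segment_compact.
  by apply/funext => x; rewrite /J /= in_itv/= ler_distl.
move: Jc; rewrite compact_cover => /(_ R J (fun a => [set x | 0 < phi a x])).
case=> [a|x Jx|T TJ JT].
- move=> /phiP[sa _ _ _]; apply: (@open_comp R R (phi a) [set y | 0 < y]).
    by move=> y _; exact: smooth_continuous.
  exact: open_gt.
- by exists x => //=; have [] := phiP x Jx.
pose t : seq R := finmap.enum_fset T.
have tJ a : a \in t -> J a by move=> /TJ; rewrite inE.
have Jt x : J x -> exists2 a, a \in t & 0 < phi a x.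
  by move=> /JT[a /= aT xa]; exists a.
pose u x := \sum_(a <- t) phi a x.
have tP a : a \in t -> [/\ smooth (phi a), forall x, 0 <= phi a x, 0 < phi a a &
    F (fun x => phi a x *: aone)].
  by move=> /tJ/phiP.
have u0 x : 0 <= u x.
  by rewrite /u big_seq sumr_ge0// => a /tP[].
have uJ x : J x -> 0 < u x.
  move=> /Jt[a at_ xa]; rewrite /u (big_rem a)//= ltr_pwDl// big_seq.
  by rewrite sumr_ge0// => b /mem_rem/tP[].
have su : smooth u.
  (* [phi a] is controlled only for [a] in [t], whereas the sum lemma wants every index; hence the
     default 0. *)
  rewrite (_ : u = fun x => \sum_(a <- t) (if a \in t then phi a else cst 0) x).
    apply: smooth_sum => a.
    by case: ifP => [/tP[sa _ _ _]|_]; [exact: sa|exact: smooth_cst].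
  by apply/funext => x; rewrite /u !big_seq; apply: eq_bigr => a ->.
have Fu : F (fun x => u x *: aone).
  rewrite (_ : (fun x => _) = fun x =>
      \sum_(a <- t) (if a \in t then fun y => phi a y *: aone else cst 0) x).
    apply: (function_ideal_sum _ FI) => a.
    by case: ifP => [/tP[_ _ _ Fa]|_]; [exact: Fa|exact: F0].
  apply/funext => x; rewrite /u scaler_suml !big_seq.
  by apply: eq_bigr => a ->.
pose theta x := flat (1 * x + (- (c + d))) + flat (-1 * x + (c - d)).
have stheta : smooth theta.
  by apply: smoothD; apply: smooth_comp_affine; exact: flat_smooth.
have theta_J x : J x -> theta x = 0.
  by rewrite /J /= ler_distl => /andP[? ?]; rewrite /theta !flat0 ?addr0//; lra.
have theta_ge0 x : 0 <= theta x by rewrite addr_ge0// flat_ge0.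
have ut x : u x + theta x != 0.
  rewrite gt_eqF//; have [/uJ ux|xJ] := leP `|x - c| d; first by rewrite ltr_pwDl.
  rewrite ltr_wpDl// /theta; move: xJ; rewrite ltr_normr => /orP[h|h].
    by rewrite ltr_pwDl ?flat_ge0// flat_gt0; lra.
  by rewrite ltr_wpDl ?flat_ge0// flat_gt0; lra.
have sinv : smooth (fun x => chi x * (u x + theta x)^-1).
  apply: smoothM; first exact: schi.
  by apply: smooth_inv; [exact: smoothD|exact: ut].
have := function_ideal_scale FI sinv Fu.
rewrite (_ : (fun x => _) = fun x => chi x *: aone)//.
apply/funext => x; rewrite scalerA; congr (_ *: _).
have [xJ|xJ] := leP d `|x - c|; first by rewrite chi0// !mul0r.
have := ut x; rewrite theta_J; last exact: ltW.
by rewrite addr0 => ux; rewrite divfK.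
Qed.

Lemma bounded_quotient_nil c d g : smooth g -> bounded_quotient c d [::] g g.
Proof.
move=> sg; split=> [//|x|i M gM]; first by rewrite root_prod_nil scale1r.
by rewrite addn0 in gM.
Qed.

(** Hadamard's lemma at [a]; the segment from [a] to [x] stays in the interval, so the bounds there
    suffice. *)
Lemma bounded_quotient_cons a c d s g q : `|a - c| <= d ->
  bounded_quotient c d s g q -> q a = 0 ->
  exists q', bounded_quotient c d (a :: s) g q'.
Proof.
move=> ac [sq gE gM] qa; have [q' [sq' qE q'M]] := hadamard a sq.
exists q'; split=> [//|x|i M HM x xc].
  by rewrite gE qE qa add0r scalerA root_prod_cons mulrC.
apply: q'M => y ayx; apply: (gM i.+1 M) => [z zc|]; last exact: between_ball ayx.
by rewrite addSnnS; exact: HM.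
Qed.

(** Induction on [N]. The cofactors of [root_prod s] form an ideal [F']: a common zero of [F'] in
    the interval is added to [s], and without one [function_ideal_bump] applies to [F']. *)
Lemma function_ideal_generator F c d N : function_ideal F ->
  exists s, [/\ (size s <= N)%N, {in s, forall a, `|a - c| <= d},
    forall g, F g -> exists q, bounded_quotient c d s g q &
    size s = N \/ forall chi : R -> R, smooth chi ->
      (forall x, d <= `|x - c| -> chi x = 0) ->
      F (fun x => chi x *: (root_prod s x *: aone))].
Proof.
move=> FI; have [Fs F0 FD FM] := FI.
elim: N => [|N [s [sN sJ Fq [sE|Fchi]]]].
- exists [::]; split=> // [g Fg|]; last by left.
  by exists g; apply: bounded_quotient_nil; exact: Fs.
- pose F' := [set q | smooth q /\ F (fun x => root_prod s x *: q x)].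
  have FI' : function_ideal F'.
    split.
    + by move=> q [].
    + split; first exact: smooth_cst.
      by rewrite (_ : (fun x => _) = cst 0)//; apply/funext => x; rewrite scaler0.
    + move=> f g [sf Ff] [sg Fg]; split; first exact: smoothD.
      rewrite (_ : (fun x => _) = (fun x => root_prod s x *: f x) +
        (fun x => root_prod s x *: g x)); first exact: FD.
      by apply/funext => x; rewrite scalerDr.
    + move=> a f sa [sf Ff]; split; first exact: smooth_amul.
      rewrite (_ : (fun x => _) = fun x => amul (a x) (root_prod s x *: f x)).
        exact: FM.
      by apply/funext => x; rewrite ascaleAr.
  have [[a ac q0]|H] := pselect (exists2 a, `|a - c| <= d & forall q, F' q -> q a = 0).
    exists (a :: s); split=> [|b|g Fg|]; rewrite /= ?sE//; last by left.
      by rewrite inE => /predU1P[->//|]; exact: sJ.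
    have [q qP] := Fq g Fg; apply: (bounded_quotient_cons ac qP).
    (* The quotient lies in [F'], since multiplying back gives [g], and therefore vanishes at
       [a]. *)
    apply: q0; have [sq gE _] := qP; split=> //.
    by rewrite (_ : (fun x => _) = g)//; apply/funext => x; rewrite gE.
  exists s; split=> //; first by rewrite sE.
  right=> chi schi chi0.
  have Fnz a : `|a - c| <= d -> exists2 q, F' q & q a != 0.
    move=> ac; apply: contrapT => Hn; apply: H; exists a => // q F'q.
    by apply: contrapT => /eqP qa; apply: Hn; exists q.
  have [_] := function_ideal_bump FI' Fnz schi chi0.
  rewrite (_ : (fun x => _) = fun x => chi x *: (root_prod s x *: aone))//.
  by apply/funext => x; rewrite !scalerA mulrC.
- by exists s; split=> //; [exact: leqW|right].
Qed.

End function_ideal.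

(** * Approximation on one small interval *)

Section local_approximation.
Variables (R : realType) (K : normedComAlgType R).
Implicit Types (F : set (R -> K)) (f g q : R -> K) (s : seq R) (c d x : R).

Lemma derivs_le_weaken (L : normedModType R) k d A B (f : R -> L) x :
  derivs_le k d A f x -> A <= B -> derivs_le k d B f x.
Proof. by move=> fA AB i ik; exact: le_trans (fA i ik) AB. Qed.

Lemma cst_derivs_le (L : normedModType R) k d (v : L) x :
  derivs_le k d `|v| (cst v : R -> L) x.
Proof.
by case=> [|i] _; rewrite ?derive1n_cst0 ?normr0 ?mulr0// expr0 mul1r.
Qed.

Lemma sub_derivs_le k d (a x : R) : 0 < d -> `|x - a| <= 2 * d ->
  derivs_le k d (2 * d) (fun y : R => y - a) x.
Proof.
move=> d0 xa; have d1E : derive1 (fun y : R => y - a) = cst 1.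
  apply: derive1_eq => y; have := is_derive_affine 1 (- a) y.
  by rewrite (_ : (fun z => _) = (fun z => z - a))//; apply/funext => z; rewrite mul1r.
case=> [|[|i]] _; first by rewrite expr0 mul1r.
  rewrite derive1Sn d1E /= normr1 expr1 mulr1.
  by rewrite -subr_ge0; lra.
by rewrite derive1Sn d1E derive1n_cst0 normr0 mulr0; lra.
Qed.

Lemma ball_dist c d a x : `|a - c| <= d -> `|x - c| <= d -> `|x - a| <= 2 * d.
Proof. by rewrite !ler_norml => /andP[? ?] /andP[? ?]; apply/andP; split; lra. Qed.

(** Each linear factor has weighted bound [2 * d] on the interval, and each Leibniz estimate costs
    [2 ^+ k]. *)
Lemma root_prod_derivs_le k c d B s f x : 0 < d -> smooth f ->
  {in s, forall a, `|a - c| <= d} -> `|x - c| <= d -> derivs_le k d B f x ->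
  derivs_le k d ((2 ^+ k.+1 * d) ^+ size s * B) (fun y => root_prod s y *: f y) x.
Proof.
move=> d0 sf + xc fB; elim: s => [|a s IH] sJ.
  rewrite expr0 mul1r (_ : (fun y => _) = f)//.
  by apply/funext => y; rewrite root_prod_nil scale1r.
rewrite (_ : (fun y => _) = fun y => (y - a) *: (root_prod s y *: f y)); last first.
  by apply/funext => y; rewrite root_prod_cons scalerA.
have ac : `|a - c| <= d by apply: sJ; rewrite mem_head.
have {}IH := IH (fun b bs => sJ b (mem_behead (s := a :: s) bs)).
have sg : smooth (fun y => root_prod s y *: f y).
  by apply: smooth_scale; [exact: smooth_root_prod|exact: sf].
have := scale_derivs_le d0 (@smooth_sub R a) sg
  (sub_derivs_le d0 (ball_dist ac xc)) IH.
by rewrite (mulrA (2 ^+ k)) -exprSr mulrA -exprS.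
Qed.

(* Unlike the remainder, the Taylor polynomial [T] must have derivatives of all
   orders [k] bounded independently of [q] and of the interval. *)
Lemma taylor_expansion n l c d q : 0 < d -> d <= 1 -> smooth q ->
  (forall i x, (i <= n + l)%N -> `|x - c| <= d -> `|derive1n i q x| <= 1) ->
  exists T r : R -> K, [/\ smooth T /\ smooth r,
    forall x, q x = T x + root_prod (nseq l c) x *: r x,
    forall i x, (i <= n)%N -> `|x - c| <= d -> `|derive1n i r x| <= 1,
    l = 0%N -> T = cst 0 &
    forall k x, `|x - c| <= d ->
      derivs_le k d (l%:R * (2 ^+ k.+1) ^+ l) T x].
Proof.
move=> d0 d1; have cc : `|c - c| <= d by rewrite subrr normr0 ltW.
elim: l q => [|l IH] q sq q1.
  exists (cst 0), q; split=> [|x|i x ni|//|k x xc].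
  - by split; [exact: smooth_cst|exact: sq].
  - by rewrite root_prod_nil scale1r add0r.
  - by apply: q1; rewrite addn0.
  - by rewrite mul0r -(@normr0 _ K); exact: cst_derivs_le.
have [q' [sq' qE q'M]] := hadamard c sq.
have [|T [r [[sT sr] q'E r1 _ TM]]] := IH q' sq'.
  move=> i x il xc; apply: q'M => y cyx; apply: q1; first by rewrite addnS ltnS.
  exact: between_ball cc xc cyx.
exists (cst (q c) + (fun x => (x - c) *: T x)), r; split=> [|x|i x|//|k x xc].
- split; last exact: sr.
  apply: smoothD; first exact: smooth_cst.
  by apply: smooth_scale; [exact: smooth_sub|exact: sT].
- rewrite qE q'E /= scalerDr addrA; congr (_ + _).
  by rewrite scalerA root_prod_cons.
- exact: r1.
have C0 : 1 <= 2 ^+ k.+1 :> R by rewrite exprn_ege1// ler1n.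
apply: derivs_le_weaken.
  apply: derivs_leD (ltW d0) _ _ (@cst_derivs_le K k d (q c) x) _.
  - exact: smooth_cst.
  - by apply: smooth_scale; [exact: smooth_sub|exact: sT].
  - exact: (scale_derivs_le d0 (@smooth_sub R c) sT
      (sub_derivs_le d0 (ball_dist cc xc)) (TM k x xc)).
have C00 := le_trans ler01 C0.
have -> : l.+1%:R = l%:R + 1 :> R by rewrite natr1.
rewrite (mulrDl l%:R 1) mul1r [leLHS]addrC lerD//.
  rewrite (mulrA (2 ^+ k)) -exprSr (exprS _ l) (mulrCA l%:R) ler_wpM2r//.
  by rewrite ler_piMr.
by rewrite (le_trans (q1 0%N c _ cc))// exprn_ege1.
Qed.

(** The [n.+2] extra derivatives of [f] pay for [n.+2] linear factors. Of the powers of [d] so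
    gained, [n] will absorb the derivatives of the cutoff, one the number of intervals, and one
    remains as the error. *)
Lemma local_approximation F n c d f : @locally_invertible R K ->
  function_ideal F -> 0 < d -> d <= 1 -> F f ->
  (forall i x, (i <= n + n.+2)%N -> `|x - c| <= d -> `|derive1n i f x| <= 1) ->
  exists P : R -> K, [/\ smooth P,
    forall chi : R -> R, smooth chi -> (forall x, d <= `|x - c| -> chi x = 0) ->
      F (fun x => chi x *: P x),
    forall x, `|x - c| <= d ->
      derivs_le n d ((2 ^+ n.+1 * d) ^+ n.+2) (f - P) x &
    forall k x, `|x - c| <= d ->
      derivs_le k d (n.+2%:R * (2 ^+ k.+1) ^+ n.+2) P x].
Proof.
move=> Kinv FI d0 d1 Ff f1; have [Fs F0 FD FM] := FI.
have [s [sN sJ Fq Fs_full]] := @function_ideal_generator R K Kinv F c d n.+2 FI.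
have [q [sq fE qM]] := Fq f Ff.
have sW := @smooth_root_prod R s.
set l := (n.+2 - size s)%N; have lE : (l + size s = n.+2)%N by rewrite subnK.
have [|T [r [[sT sr] qE r1 T0 TM]]] := @taylor_expansion n l c d q d0 d1 sq.
  move=> i x il; apply: qM => y; apply: f1.
  by rewrite -lE addnA leq_add2r.
have sP : smooth (fun x => root_prod s x *: T x) by exact: smooth_scale.
exists (fun x => root_prod s x *: T x); split=> [//|chi schi chi0|x xc|k x xc].
- case: Fs_full => [sE|Fchi].
    (* Here all factors come from zeros, so [l = 0] and [T] vanishes. *)
    rewrite (_ : (fun x => _) = cst 0)//; apply/funext => x.
    by rewrite T0 ?scaler0// /l sE subnn.
  have := FM _ _ sT (Fchi chi schi chi0).
  rewrite (_ : (fun x => _) = fun x => chi x *: (root_prod s x *: T x))//.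
  by apply/funext => x; rewrite !scalerA -ascaleAr amulC amul1.
- rewrite (_ : f - _ = fun x => root_prod (nseq l c ++ s) x *: r x); last first.
    apply/funext => y; rewrite -[LHS]/(f y - root_prod s y *: T y).
    by rewrite fE qE scalerDr addrAC subrr add0r scalerA root_prod_cat mulrC.
  have sE : size (nseq l c ++ s) = n.+2 by rewrite size_cat size_nseq.
  rewrite -[X in derivs_le _ _ X](mulr1 (_ ^+ _)) -[X in _ ^+ X * 1]sE.
  apply: (root_prod_derivs_le d0 sr _ xc).
    move=> a; rewrite mem_cat mem_nseq => /orP[/andP[_ /eqP->]|/sJ//].
    by rewrite subrr normr0 ltW.
  move=> i ni; rewrite -[leRHS]mulr1 ler_pM ?exprn_ge0 ?(ltW d0)//.
    by rewrite exprn_ile1 ?(ltW d0).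
  exact: r1.
- apply: derivs_le_weaken (root_prod_derivs_le d0 sT sJ xc (TM k x xc)) _.
  have C0 : 1 <= 2 ^+ k.+1 :> R by rewrite exprn_ege1// ler1n.
  have C00 := le_trans ler01 C0.
  have -> : n.+2%:R * (2 ^+ k.+1) ^+ n.+2 =
      (2 ^+ k.+1) ^+ size s * (n.+2%:R * (2 ^+ k.+1) ^+ l) :> R.
    by rewrite [RHS]mulrCA -exprD addnC lE.
  apply: ler_pM.
  + by rewrite exprn_ge0// mulr_ge0// ltW.
  + by rewrite mulr_ge0// exprn_ge0.
  + by rewrite exprMn ler_piMr ?exprn_ge0// exprn_ile1 ?(ltW d0).
  + by rewrite ler_wpM2r ?exprn_ge0// ler_nat /l leq_subr.
Qed.

End local_approximation.

(** * Gluing the local approximations *)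

Section approximation.
Variables (R : realType) (K : normedComAlgType R).
Implicit Types (F : set (R -> K)) (f g : R -> K) (psi : R -> R) (x : R).

(** Near [c], removing the weights from the Leibniz estimate costs at most [N%:R ^+ k]; elsewhere
    the product vanishes on an open set. *)
Lemma scaled_bump_derivs psi k N (b A B : R) g c : (0 < N)%N ->
  smooth psi -> (forall x, 1 <= `|x| -> psi x = 0) ->
  (forall j x, (j <= k)%N -> `|derive1n j psi x| <= A) ->
  (forall x, N%:R * x + b = N%:R * (x - c)) -> 0 <= B -> smooth g ->
  (forall x, `|x - c| <= N%:R^-1 -> derivs_le k N%:R^-1 B g x) ->
  forall j x, (j <= k)%N ->
    `|derive1n j (fun y => psi (N%:R * y + b) *: g y) x| <=
    N%:R ^+ k * (2 ^+ k * A * B).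
Proof.
move=> N0 sp p0 pA bc B0 sg gB j x jk.
have n0 : 0 < N%:R :> R by rewrite ltr0n.
have A0 : 0 <= A by apply: le_trans (pA 0%N 0 _).
have sps : smooth (fun y => psi (N%:R * y + b)) by exact: smooth_comp_affine.
have M0 : 0 <= 2 ^+ k * A * B by rewrite !mulr_ge0.
have [xc|xc] := leP `|x - c| N%:R^-1; last first.
  have oU : open [set y : R | N%:R^-1 < `|y - c|].
    apply: (@open_comp R R (fun y => `|y - c|) [set y | N%:R^-1 < y]);
      last exact: open_gt.
    move=> y _; apply: cvg_norm; apply: cvgB; [exact: cvg_id|exact: cvg_cst].
  rewrite (derive1n_open0 oU) ?normr0 ?mulr_ge0 ?exprn_ge0 ?(ltW n0)//.
  move=> y /= yc; rewrite bc p0 ?scale0r// normrM (gtr0_norm n0).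
  by rewrite mulrC -ler_pdivrMr// div1r ltW.
have psb : derivs_le k N%:R^-1 A (fun y => psi (N%:R * y + b)) x.
  move=> i ik; rewrite derive1n_comp_affine// normrM normrX (gtr0_norm n0).
  by rewrite mulrA -exprMn mulVf ?gt_eqF// expr1n mul1r pA.
have := @scale_derivs_le R K k _ A B _ g x _ sps sg psb (gB x xc) j jk.
rewrite invr_gt0 => /(_ n0); rewrite exprVn ler_pdivrMl ?exprn_gt0//.
move=> /le_trans; apply; rewrite ler_wpM2r//.
by rewrite ler_weXn2l// ler1n.
Qed.

Lemma smooth_approximation F n k N f psi (A : R) : @locally_invertible R K ->
  function_ideal F -> F f ->
  (forall i x, (i <= n + n.+2)%N -> `|x| <= (n + n.+2)%:R -> `|derive1n i f x| <= 1) ->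
  smooth psi -> (forall x, 1 <= `|x| -> psi x = 0) ->
  (forall (L : nat) z, 0 <= z <= L%:R -> \sum_(t < L.+1) psi (z - t%:R) = 1) ->
  (n <= k)%N -> (forall j x, (j <= k)%N -> `|derive1n j psi x| <= A) -> (0 < N)%N ->
  exists y : R -> K, [/\ F y,
    forall j x, (j <= n)%N -> `|x| <= n%:R -> `|derive1n j (f - y) x| <=
      (n.*2.+3)%:R * (2 ^+ n * A * (2 ^+ n.+1) ^+ n.+2) / N%:R &
    forall j x, (j <= k)%N -> `|derive1n j y x| <=
      (n.*2.+3)%:R * (2 ^+ k * A * (n.+2%:R * (2 ^+ k.+1) ^+ n.+2)) * N%:R ^+ k.+1].
Proof.
move=> Kinv FI Ff f1 sp p0 p1 nk pA N0; have [Fs F0 FD FM] := FI.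
have n0 : 0 < N%:R :> R by rewrite ltr0n.
have A0 : 0 <= A by apply: le_trans (pA 0%N 0 _).
pose d : R := N%:R^-1; have d0 : 0 < d by rewrite invr_gt0.
have d1 : d <= 1 by rewrite invf_le1// ler1n.
(* The centres [c t] run from [- (n%:R + d)] to [n%:R + d] in steps of [d], one step beyond
   [[-n, n]] on either side. *)
pose L := ((n * N).*2.+2)%N.
have LE : L%:R = 2 * (n%:R * N%:R + 1) :> R.
  by rewrite /L -addnn -!natr1 natrD natrM; ring.
have LN : L.+1%:R <= (n.*2.+3)%:R * N%:R :> R.
  rewrite -natrM ler_nat /L -[in leqRHS]addn3 mulnDl -doubleMl -addn3.
  by rewrite leq_add2l leq_pmulr.
pose b (t : 'I_L.+1) : R := n%:R * N%:R + 1 - t%:R.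
pose c (t : 'I_L.+1) : R := - (d * b t).
have bc t x : N%:R * x + b t = N%:R * (x - c t).
  by rewrite /c opprK mulrDr mulrA /d divff ?mul1r// gt_eqF.
have cJ t x : `|x - c t| <= d -> `|x| <= (n + n.+2)%:R.
  move=> xc.
  have : `|x| <= n%:R + d + d.
    rewrite -(subrK (c t) x) (le_trans (ler_normD _ _))// addrC lerD//.
    rewrite /c normrN normrM (gtr0_norm d0) /d ler_pdivrMl//.
    rewrite mulrDr divff ?gt_eqF// mulrC ler_norml /b.
    have t0 : 0 <= t%:R :> R by [].
    have tL : t%:R <= L%:R :> R by rewrite ler_nat -ltnS.
    by rewrite LE in tL; apply/andP; split; lra.
  move=> /le_trans; apply; rewrite natrD -addrA lerD2l (le_trans (lerD d1 d1))//.
  by rewrite (ler_nat R 2 n.+2).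
have /choice[P PP] : forall t, exists P : R -> K, [/\ smooth P,
    forall chi : R -> R, smooth chi -> (forall x, d <= `|x - c t| -> chi x = 0) ->
      F (fun x => chi x *: P x),
    forall x, `|x - c t| <= d ->
      derivs_le n d ((2 ^+ n.+1 * d) ^+ n.+2) (f - P) x &
    forall k x, `|x - c t| <= d ->
      derivs_le k d (n.+2%:R * (2 ^+ k.+1) ^+ n.+2) P x].
  move=> t; apply: (local_approximation Kinv FI d0 d1 Ff) => i x im xc.
  by apply: f1 im _; exact: cJ xc.
pose chi t x := psi (N%:R * x + b t).
have schi t : smooth (chi t) by exact: smooth_comp_affine.
have sf := Fs _ Ff.
have sP t : smooth (P t) by have [] := PP t.
have sfP t : smooth (f - P t) by exact: smoothB.
exists (fun x => \sum_t chi t x *: P t x); split.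
- apply: (@function_ideal_sum _ _ F _ _ (fun t x => chi t x *: P t x) FI) => t.
  have [_ FP _ _] := PP t; apply: FP; first exact: schi.
  move=> x xc; rewrite /chi bc p0//.
  by rewrite normrM (gtr0_norm n0) mulrC -ler_pdivrMr// div1r.
- move=> j x jn xn.
  (* The cutoffs sum to 1 on this open neighbourhood of [[-n, n]], so derivatives can be compared at
     the end points too. *)
  pose U := [set y : R | `|y| < n%:R + d].
  have oU : open U.
    apply: (@open_comp R R (@Num.norm R R) [set y | y < n%:R + d]); last exact: open_lt.
    by move=> y _; exact: norm_continuous.
  have Ux : U x by rewrite /U /= (le_lt_trans xn)// ltrDl.
  rewrite (@derive1n_open_eq _ _ U _
    (fun y => \sum_t chi t y *: (f - P t) y) oU _ _ _ Ux); last first.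
    move=> y; rewrite /U /= ltr_norml => /andP[y1 y2].
    rewrite -[LHS]/(f y - \sum_t chi t y *: P t y).
    have chi1 : \sum_t chi t y = 1.
      rewrite -(p1 L (N%:R * y + (n%:R * N%:R + 1))).
        by apply: eq_bigr => t _; rewrite /chi /b addrA.
      have := ltr_pM2l n0 y (n%:R + d); have := ltr_pM2l n0 (- (n%:R + d)) y.
      rewrite y1 y2 LE mulrN !mulrDr {1 2}/d divff ?gt_eqF//.
      by move=> /esym h1 /esym h2; apply/andP; split; lra.
    rewrite -[f y in LHS]scale1r -chi1 scaler_suml -sumrB.
    by apply: eq_bigr => t _; rewrite scalerBr.
  rewrite derive1n_sum; last by move=> t; exact: (smooth_scale (schi t) (sfP t)).
  rewrite (le_trans (ler_norm_sum _ _ _))//.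
  (* [N%:R ^+ n] from the cutoff meets [d ^+ n.+2] from the remainder; the number of terms is
     O(N). *)
  apply: (@le_trans _ _ (\sum_(t < L.+1) 2 ^+ n * A * (2 ^+ n.+1) ^+ n.+2 / N%:R ^+ 2)).
    apply: ler_sum => t _; have [_ _ fPB _] := PP t.
    apply: le_trans (scaled_bump_derivs N0 sp p0 _ (bc t) _ (sfP t) fPB _ jn) _.
    + by move=> i z ik; apply: pA; exact: leq_trans nk.
    + by rewrite exprn_ge0// mulr_ge0 ?exprn_ge0// ltW.
    + have E : N%:R ^+ n * d ^+ n.+2 = (N%:R ^+ 2)^-1.
        rewrite -addn2 exprD /d !exprVn mulrA divff ?mul1r//.
        by rewrite gt_eqF// exprn_gt0.
      by rewrite exprMn mulrCA (mulrCA _ (_ ^+ n.+2)) E !mulrA.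
  rewrite sumr_const card_ord -[_ *+ L.+1]mulr_natl.
  set C := 2 ^+ n * A * _.
  have C0 : 0 <= C by apply: mulr_ge0; [apply: mulr_ge0|]; rewrite // !exprn_ge0.
  have -> : (n.*2.+3)%:R * C / N%:R = (n.*2.+3)%:R * N%:R * (C / N%:R ^+ 2).
    by field; rewrite gt_eqF.
  by rewrite ler_wpM2r// divr_ge0// exprn_ge0// ltW.
- move=> j x jk.
  rewrite derive1n_sum; last by move=> t; exact: (smooth_scale (schi t) (sP t)).
  rewrite (le_trans (ler_norm_sum _ _ _))//.
  set E := 2 ^+ k * A * _.
  (* Counting all [L.+1] terms, not just the at most two nonzero at a point, is what raises the
     exponent to [k.+1]. *)
  apply: (@le_trans _ _ (\sum_(t < L.+1) N%:R ^+ k * E)).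
    apply: ler_sum => t _; have [_ _ _ PB] := PP t.
    apply: (scaled_bump_derivs N0 sp p0 pA (bc t) _ (sP t) (PB k) _ jk).
    by rewrite mulr_ge0 ?exprn_ge0.
  have E0 : 0 <= E.
    by apply: mulr_ge0; apply: mulr_ge0; rewrite // !exprn_ge0.
  rewrite sumr_const card_ord -[_ *+ L.+1]mulr_natl exprS.
  have -> : (n.*2.+3)%:R * E * (N%:R * N%:R ^+ k) =
      (n.*2.+3)%:R * N%:R * (N%:R ^+ k * E) by ring.
  by rewrite ler_wpM2r// mulr_ge0// exprn_ge0// ltW.
Qed.

End approximation.

(** * Property [Omega] for ideals *)

Section omega.
Variables (R : realType) (K : normedComAlgType R).

Lemma ideal_function_ideal (I : set (Cinfty K)) : is_ideal I ->
  function_ideal [set f : R -> K | exists2 g : Cinfty K, I g & f = g].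
Proof.
move=> [I0 ID IM]; split.
- by move=> _ [g _ ->]; exact: CinftyP.
- by exists 0.
- move=> _ _ [g Ig ->] [h Ih ->].
  by exists (g + h); first exact: ID.
- move=> a _ sa [g Ig ->].
  by exists (mkCinfty sa * g); first exact: IM.
Qed.

Lemma ideal_Omega (I : set (Cinfty K)) : @locally_invertible R K -> is_ideal I ->
  Omega (@seminorm R K) I.
Proof.
move=> Kinv HI; have FI := ideal_function_ideal HI.
have [psi [sp p0 p1]] := smooth_partition_of_unity R.
(* As an order, [n + n.+2] is what the local approximation consumes; as a radius, it leaves room for
   the intervals sticking out of [[-n, n]]. *)
move=> n; exists (n + n.+2)%N; first exact: leq_addr.
move=> k mk; have nk : (n <= k)%N by apply: leq_trans mk; exact: leq_addr.
have [A pA] := derivs_bounded_of_support k sp p0.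
have A0 : 0 <= A by apply: le_trans (pA 0%N 0 _).
set C2 := (n.*2.+3)%:R * (2 ^+ n * A * (2 ^+ n.+1) ^+ n.+2).
set C3 := (n.*2.+3)%:R * (2 ^+ k * A * (n.+2%:R * (2 ^+ k.+1) ^+ n.+2)).
have C20 : 0 <= C2.
  apply: mulr_ge0 => //; apply: mulr_ge0; last by rewrite !exprn_ge0.
  by rewrite mulr_ge0// exprn_ge0.
have C30 : 0 <= C3.
  apply: mulr_ge0 => //; apply: mulr_ge0; first by rewrite mulr_ge0// exprn_ge0.
  by apply: mulr_ge0; rewrite // !exprn_ge0.
(* [(C2 + 1) / e] will bound [N], whence the power; the 1 added to [C3] ensures positivity. *)
have c0 : 0 < (C3 + 1) * (C2 + 1) ^+ k.+1.
  by apply: mulr_gt0; [|apply: exprn_gt0]; rewrite ltr_wpDl.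
exists k.+1, ((C3 + 1) * (C2 + 1) ^+ k.+1); split=> // e f e0 If f1.
(* For [e] at least 1 the approximant 0 is good enough. *)
have [e1|e1] := leP 1 e.
  exists 0; have [I0 _ _] := HI; split=> //.
    rewrite subr0 (le_trans _ e1)// (le_trans _ f1)//.
    by apply: seminorm_homo; exact: leq_addr.
  by rewrite seminorm0 divr_ge0 ?(ltW c0)// exprn_ge0// ltW.
(* This gives [C2 / N <= e] and, as [e < 1], also [N <= (C2 + 1) / e]. *)
pose N := (Num.truncn (C2 / e)).+1.
have N0 : 0 < N%:R :> R by rewrite ltr0n.
have Ce0 : 0 <= C2 / e by rewrite divr_ge0// ltW.
have /andP[Nle Ngt] := truncn_itv Ce0.
have [||_ [[g Ig ->] fg gk]] :=
  @smooth_approximation R K _ n k N f psi A Kinv FI _ _ sp p0 p1 nk pA isT.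
- by exists f.
- by move=> i x im xm; rewrite (le_trans _ f1)//; exact: seminorm_ub.
exists g; split=> //.
  apply: seminorm_le => j x jn xn; apply: le_trans (fg j x jn xn) _.
  by rewrite ler_pdivrMr// [leRHS]mulrC -ler_pdivrMr// ltW.
apply: seminorm_le => j x jk _; apply: le_trans (gk j x jk) _.
rewrite -[leRHS]mulrA; apply: ler_pM => //; first by rewrite lerDl.
rewrite -exprVn -exprMn lerXn2r ?nnegrE ?mulr_ge0 ?invr_ge0 ?addr_ge0 ?(ltW e0)//.
rewrite ler_pdivlMr// /N -natr1 mulrDl mul1r lerD ?(ltW e1)//.
by rewrite -ler_pdivlMr.
Qed.

End omega.

(** * The real and the complex scalars *)

Section scalar_fields.
Variable R : realType.

(** A linear contraction does not enlarge the first-order error, so it commutes with derivation;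
    meant for real and imaginary parts. *)
Lemma smooth_linear (K L : normedModType R) (h : K -> L) (f : R -> K) :
  (forall u v, h (u - v) = h u - h v) -> (forall (k : R) u, h (k *: u) = k *: h u) ->
  (forall u, `|h u| <= `|u|) -> smooth f -> smooth (h \o f).
Proof.
move=> hB hZ hle sf; apply: (@smooth_stable R L
  [set g | exists2 f : R -> K, smooth f & g = h \o f]); last by exists f.
move=> _ [q sq ->]; exists (h \o derive1 q).
  by exists (derive1 q); [exact: smooth_derive1|].
move=> x; apply/is_derive1P => e e0.
have [r r0 Hr] := (is_derive1P _ _ _).1 (smooth_is_derive x sq) e e0.
exists r => // t tr; rewrite /= -hZ -!hB; exact: le_trans (hle _) (Hr t tr).
Qed.

Lemma real_locally_invertible : @locally_invertible R R.
Proof.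
move=> q a sq qa; exists q, (fun x => q x * q x); split=> [||x|x|].
- exact: sq.
- exact: (smoothM sq sq).
- by rewrite /GRing.scale/= mulr1.
- by rewrite -expr2 sqr_ge0.
- by rewrite -expr2 exprn_even_gt0.
Qed.

Lemma complex_locally_invertible : @locally_invertible R (Rcomplex R).
Proof.
pose re : Rcomplex R -> R := @complex.Re R.
pose im : Rcomplex R -> R := @complex.Im R.
have sre (q : R -> Rcomplex R) : smooth q -> smooth (re \o q).
  apply: smooth_linear => [[? ?] [? ?]//|? [? ?]//|[a b]].
  rewrite [leRHS]/Num.norm /= -sqrtr_sqr ler_wsqrtr// lerDl sqr_ge0//.
have sim (q : R -> Rcomplex R) : smooth q -> smooth (im \o q).
  apply: smooth_linear => [[? ?] [? ?]//|? [? ?]//|[a b]].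
  rewrite [leRHS]/Num.norm /= -sqrtr_sqr ler_wsqrtr// lerDr sqr_ge0//.
(* [i] is minus the imaginary unit, which makes the first witness the conjugate of [q]. *)
move=> q a sq qa; pose i : Rcomplex R := @complex.Complex R 0 (-1).
exists ((fun x => (re \o q) x *: (aone : Rcomplex R)) + (fun x => (im \o q) x *: i)).
exists ((fun x => (re \o q) x * (re \o q) x) + (fun x => (im \o q) x * (im \o q) x)).
split=> [||x|x|].
- by apply: smoothD; apply: smooth_scalev; [exact: (sre q sq)|exact: (sim q sq)].
- by apply: smoothD;
    [exact: smoothM (sre q sq) (sre q sq)|exact: smoothM (sim q sq) (sim q sq)].
- rewrite -[LHS]/(amul (re (q x) *: aone + im (q x) *: i) (q x)).
  rewrite -[RHS]/((re (q x) * re (q x) + im (q x) * im (q x)) *: aone).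
  case: (q x) => y z; apply/eqP; rewrite eq_complex /=.
  by apply/andP; split; apply/eqP; ring.
- by rewrite addr_ge0// -expr2 sqr_ge0.
- rewrite -[ltRHS]/(re (q a) * re (q a) + im (q a) * im (q a)) -!expr2.
  rewrite lt0r addr_ge0 ?sqr_ge0// andbT paddr_eq0 ?sqr_ge0// !sqrf_eq0.
  by move: qa; rewrite eq_complex.
Qed.

End scalar_fields.

Theorem theorem2p1 (R : realType) :
  (forall I : set (@Cinfty R R),
     is_ideal I -> closed I -> Omega (@seminorm R R) I) /\
  (forall I : set (@Cinfty R (Rcomplex R)),
     is_ideal I -> closed I -> Omega (@seminorm R (Rcomplex R)) I).
Proof.
split=> I HI _; apply: ideal_Omega => //.
  exact: real_locally_invertible.
exact: complex_locally_invertible.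
Qed.
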